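(* Let $n\ge1$. The bracket $$[\![u(x,p)\partial_x,\,v(x,p)\partial_x]\!]=\bigl(u(x,p)v_x(x,p)-v(x,p)u_x(x,p)\bigr)\partial_x+\sum_{i=1}^n\bigl(u(p_i,p)\,v_{p_i}(x,p)-v(p_i,p)\,u_{p_i}(x,p)\bigr)\partial_x$$ on smooth sections and the anchor map $\#:\mathrm{BVect}_n(S^1)\to TB$ sending a broken vector field to its values at the break points, $\#(u\,\partial_x)=\sum_{i=1}^n u(p_i)\,\partial_{p_i}$ over $p=(p_1,\dots,p_n)$, turn the vector bundle $\mathrm{BVect}_n(S^1)\to B$ into a Lie algebroid. That is: the bracket of two smooth sections (given by the formula for $x\notin\{p_1,\dots,p_n\}$) is again a smooth section (in particular it extends continuously across $x=p_i$); it is a Lie bracket on the space of smooth sections; and $[\![\mathbf u,f\mathbf v]\!]=f[\![\mathbf u,\mathbf v]\!]+(L_{\#\mathbf u}f)\,\mathbf v$ for all smooth sections $\mathbf u,\mathbf v$ and all $f\in C^\infty(B)$.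
   Context: $S^1=\mathbb R/\mathbb Z$ with coordinate $x$; $B\subset (S^1)^n$ is the manifold of $n$-tuples $p=(p_1,\dots,p_n)$ of distinct cyclically ordered points; $p_{n+1}:=p_1$; $[p_i,p_{i+1}]$ is the positively oriented arc from $p_i$ to $p_{i+1}$ (for $n=1$, the whole circle cut at $p_1$). A vector field with breaks at $p_1,\dots,p_n$ is a continuous vector field $u(x)\partial_x$ on $S^1$ which on each arc $[p_i,p_{i+1}]$ is smooth up to the boundary (smooth on $S^1\setminus\{p_1,\dots,p_n\}$, with one-sided derivatives of all orders at each $p_i$). $\mathrm{BVect}_n(S^1)\to B$ is the vector bundle whose fiber over $p$ is the space of vector fields with breaks at $p_1,\dots,p_n$. A smooth section is a family $\mathbf u=u(x,p)\partial_x$ with $u$ continuous on $S^1\times B$ and smooth up to the boundary on each connected component of the complement of the hypersurfaces $\{x=p_i\}$ (i.e. smooth on the manifold with boundary obtained by cutting $S^1\times B$ along these hypersurfaces). A Lie algebroid over $B$ is a vector bundle $A\to B$ with a Lie bracket on its smooth sections and a bundle morphism $\#:A\to TB$ (the anchor) satisfying $[\mathbf u,f\mathbf v]=f[\mathbf u,\mathbf v]+(L_{\#\mathbf u}f)\mathbf v$, where $L_Xf$ is the derivative of $f$ along the vector field $X$. Subscripts denote partial derivatives. *)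

(* Defs.v *)
From HB Require Import structures.
From mathcomp Require Import all_boot all_order all_algebra.
From mathcomp Require Import all_classical all_reals all_analysis.

Set Implicit Arguments.
Unset Strict Implicit.
Unset Printing Implicit Defensive.

Import Order.TTheory GRing.Theory Num.Theory.
Import numFieldTopology.Exports numFieldNormedType.Exports.

Local Open Scope ring_scope.
Local Open Scope classical_set_scope.

(* Conventions.  The circle is R/Z and everything is pulled back along the
   covering maps R -> R/Z and R^n -> (R/Z)^n:
   - a point of (R/Z)^n is represented by any p : 'rV_n lifting it, a point of
     S^1 x (R/Z)^n by a pair (x, p);
   - a function on B (resp. S^1 x B) is a Z^n- (resp. Z x Z^n-) periodic
     function on the preimage of B; its values elsewhere are irrelevant, and
     two such functions are identified when they agree over B;
   - a vector field u(x) d/dx is represented by its coefficient u. *)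

Section Smooth.
Context {R : realType} {V : normedModType R}.
Implicit Types (U : set V) (f : V -> R).

(* k-times Frechet differentiable; the differential of f is encoded by the
   functions 'D_v f. *)
Fixpoint ndifferentiable_on (k : nat) U f : Prop :=
  if k is k'.+1 then
    (forall z, U z -> differentiable f z) /\
    (forall v : V, ndifferentiable_on k' U ('D_v f))
  else forall z, U z -> {for z, continuous f}.

(* Meant for open U. *)
Definition smooth_on U f := forall k, ndifferentiable_on k U f.

Definition smooth_at (z : V) f := exists2 U, open_nbhs z U & smooth_on U f.

End Smooth.

Section Base.
Context {R : realType} {n : nat}.
Implicit Types (p : 'rV[R]_n) (m : 'rV[int]_n).

Definition lattice m : 'rV[R]_n := map_mx intr m.

(* The preimage in R^n of the manifold of n-tuples of distinct cyclically
   ordered points: some lift q of the same point of (R/Z)^n satisfies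
   q_1 < q_2 < ... < q_n < q_1 + 1. *)
Definition cyc_ordered : set 'rV[R]_n := [set p : 'rV[R]_n |
  exists m, forall i j : 'I_n, (i < j)%N ->
    (p + lattice m) 0 i < (p + lattice m) 0 j < (p + lattice m) 0 i + 1].

Definition is_break p (x : R) := exists (i : 'I_n) (k : int), x = p 0 i + k%:~R.

Variable B : set 'rV[R]_n.

Definition smooth_fun (f : 'rV[R]_n -> R) :=
  (forall p m, B p -> f (p + lattice m) = f p) /\ smooth_on B f.

Definition smooth_vector_field (X : 'rV[R]_n -> 'rV[R]_n) :=
  forall i, smooth_fun (fun p => X p 0 i).

Definition eq_over (u v : R * 'rV[R]_n -> R) :=
  forall x p, B p -> u (x, p) = v (x, p).

(* A Lie algebroid structure on a bundle over B whose fiber over p is the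
   space of functions fiber p, and whose space of smooth sections is sections,
   a section being a family u (x, p) with u (-, p) in the fiber over p. *)
Record lie_algebroid
    (fiber : 'rV[R]_n -> set (R -> R))
    (sections : set (R * 'rV[R]_n -> R))
    (bracket : (R * 'rV[R]_n -> R) -> (R * 'rV[R]_n -> R) ->
               R * 'rV[R]_n -> R)
    (anchor : 'rV[R]_n -> (R -> R) -> 'rV[R]_n) : Prop := LieAlgebroid {
  fiber0 : forall p, B p -> fiber p 0 ;
  fiberP : forall p (a : R) (w1 w2 : R -> R), B p ->
    fiber p w1 -> fiber p w2 -> fiber p (a *: w1 + w2) ;
  section_fiber : forall u, sections u ->
    forall p, B p -> fiber p (fun x => u (x, p)) ;
  section0 : sections 0 ;
  sectionD : forall u v, sections u -> sections v -> sections (u + v) ;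
  sectionM : forall f u, smooth_fun f -> sections u ->
    sections (fun z => f z.2 * u z) ;
  anchor_linear : forall p (a : R) (w1 w2 : R -> R), B p ->
    fiber p w1 -> fiber p w2 ->
    anchor p (a *: w1 + w2) = a *: anchor p w1 + anchor p w2 ;
  anchor_smooth : forall u, sections u ->
    smooth_vector_field (fun p => anchor p (fun x => u (x, p))) ;
  bracket_section : forall u v, sections u -> sections v ->
    sections (bracket u v) ;
  bracket_ext : forall u u' v v', sections u -> sections u' ->
    sections v -> sections v' -> eq_over u u' -> eq_over v v' ->
    eq_over (bracket u v) (bracket u' v') ;
  bracket_linearl : forall (a : R) u u' v, sections u -> sections u' ->
    sections v ->
    eq_over (bracket (a *: u + u') v) (a *: bracket u v + bracket u' v) ;
  bracket_linearr : forall (a : R) u v v', sections u -> sections v ->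
    sections v' ->
    eq_over (bracket u (a *: v + v')) (a *: bracket u v + bracket u v') ;
  bracket_antisym : forall u v, sections u -> sections v ->
    eq_over (bracket u v) (- bracket v u) ;
  bracket_jacobi : forall u v w, sections u -> sections v -> sections w ->
    eq_over (bracket u (bracket v w) + bracket v (bracket w u)
             + bracket w (bracket u v)) 0 ;
  bracket_leibniz : forall u v f, sections u -> sections v -> smooth_fun f ->
    eq_over (bracket u (fun z => f z.2 * v z))
      (fun z => f z.2 * bracket u v z
        + 'D_(anchor z.2 (fun x => u (x, z.2))) f z.2 * v z) }.

End Base.

Section BVect.
Context {R : realType} {n : nat}.
Implicit Types (p : 'rV[R]_n) (w : R -> R) (u v : R * 'rV[R]_n -> R).

(* One-sided derivatives of all orders of w at a, on the side given by the
   filter F (a^'- or a^'+); d k is the k-th one, and the (k.+1)-st is the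
   one-sided derivative at a of the k-th derivative of w on that side. *)
Definition one_sided_derivatives w (a : R) (F : set_system R) :=
  exists d : nat -> R, d 0%N = w a /\
    forall k : nat, (derive1n k w x - d k) / (x - a) @[x --> F] --> d k.+1.

(* The fiber of BVect_n over p; one-sided derivatives at the other lifts of
   the break points are given by periodicity. *)
Definition broken_field p : set (R -> R) := [set w : R -> R |
  [/\ forall x, w (x + 1) = w x,
      continuous w,
      forall (k : nat) x, ~ is_break p x -> derivable (derive1n k w) x 1 &
      forall i, one_sided_derivatives w (p 0 i) (p 0 i)^'- /\
                one_sided_derivatives w (p 0 i) (p 0 i)^'+ ]].

(* Smoothness on S^1 x B cut along the hypersurfaces {x = p_i}: u is smooth off
   the hypersurfaces and, near a point of {x = p_i}, on each closed side it is
   the restriction of a smooth function defined on a full neighborhood.  The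
   only lifted hypersurface near (p_i, p) is {x = p_i} since the p_j are
   distinct in S^1; other lifts of it are dealt with by periodicity in x. *)
Definition smooth_on_cut u :=
  smooth_on [set z : R * 'rV[R]_n | cyc_ordered z.2 /\ ~ is_break z.2 z.1] u /\
  forall p i, cyc_ordered p ->
    (exists2 g, smooth_at (p 0 i, p) g &
       \forall z \near (p 0 i, p), z.1 <= (z.2 : 'rV[R]_n) 0 i -> u z = g z) /\
    (exists2 g, smooth_at (p 0 i, p) g &
       \forall z \near (p 0 i, p), (z.2 : 'rV[R]_n) 0 i <= z.1 -> u z = g z).

Definition smooth_section : set (R * 'rV[R]_n -> R) := [set u : R * 'rV[R]_n -> R |
  [/\ forall p, cyc_ordered p -> broken_field p (fun x => u (x, p)),
      forall x p m, cyc_ordered p -> u (x, p + lattice m) = u (x, p),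
      forall z, cyc_ordered z.2 -> {for z, continuous u} &
      smooth_on_cut u ]].

(* u_x and u_{p_i} *)
Definition dx u : R * 'rV[R]_n -> R := 'D_((1, 0) : R * 'rV[R]_n) u.
Definition dp (i : 'I_n) u : R * 'rV[R]_n -> R :=
  'D_((0, delta_mx 0 i) : R * 'rV[R]_n) u.

Definition bracket_formula u v (z : R * 'rV[R]_n) : R :=
  (u z * dx v z - v z * dx u z)
  + \sum_(i < n) (u (z.2 0 i, z.2) * dp i v z - v (z.2 0 i, z.2) * dp i u z).

(* The formula off the break points, and its limit in x at the break points. *)
Definition broken_bracket u v (z : R * 'rV[R]_n) : R :=
  if `[< is_break z.2 z.1 >]
  then lim (bracket_formula u v (x, z.2) @[x --> z.1^'])
  else bracket_formula u v z.

Definition broken_anchor p w : 'rV[R]_n := \row_i w (p 0 i).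

End BVect.

(* Main.v *)
From HB Require Import structures.
Require Import Defs.
From mathcomp Require Import all_boot all_order all_algebra.
From mathcomp Require Import all_classical all_reals all_analysis.
From mathcomp Require Import ring zify.

(** Write e_0 = d/dx and e_i = d/dp_i for the constant frame of R x R^n, and lift
   a section u to the vector field X_u = u e_0 + sum_i u(p_i, p) e_i.  Off the
   hypersurfaces x = p_i the bracket formula is X_u v - X_v u, the first
   component of the commutator [X_u, X_v].

   At a break point, let g and h be the smooth extensions of u and v from one
   side.  Since X_u is tangent to the hypersurface x = p_i, along it X_u h is the
   derivative of the function v(p_i, p) of p alone along the anchor of u
   ([lie_derivative_on_break_point]).  The extension of the bracket built from g
   and h therefore takes on x = p_i the value
     # u (v(p_i, p)) - # v (u(p_i, p)),
   which does not depend on the side.  So the bracket extends continuously and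
   smoothly on each closed side ([smooth_section_bracket]), and the displayed
   value ([broken_bracket_break_value]) says that the anchor takes the bracket
   to the commutator of vector fields on the base.  Hence all components of
   [X_u, X_v] agree with those of X_[[u,v]] ([components_bracket]), and the
   Jacobi identity off the breaks becomes the one for derivations
   ([broken_bracket_nested]).

   The identities are checked off the break points, where they are algebra with
   first derivatives, plus the symmetry of second derivatives ([schwarz]) for
   the Jacobi identity.  They extend to the break points because both sides are
   continuous in x and break points are isolated ([eq_off_breaks]).

   A function is a smooth section as soon as it is periodic and smooth on the cut
   space ([smooth_section_of_cut]): continuity and the one-sided derivatives of each
   slice follow from the one-sided smooth extensions. *)

Set Implicit Arguments.
Unset Strict Implicit.
Unset Printing Implicit Defensive.

Import Order.TTheory GRing.Theory Num.Theory.
Import numFieldTopology.Exports numFieldNormedType.Exports.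

Local Open Scope ring_scope.
Local Open Scope classical_set_scope.

(** * Calculus of smooth functions *)

Section SmoothCalculus.
Context {R : realType} {V : normedModType R}.
Implicit Types (U : set V) (f g : V -> R) (z v : V).

Lemma near_eq_differentiable f g z :
  (\near z, f z = g z) -> differentiable f z -> differentiable g z.
Proof.
move=> fg df.
have [df1 df2] := (diff_locallyP z f).1 df.
have E : g \o shift z = cst (g z) + 'd f z +o_ 0 id.
  rewrite -(nbhs_singleton fg).
  apply/eqaddoP => e e0; move/eqaddoP : df2 => /(_ e e0).
  have : \forall h \near (0 : V), f (h + z) = g (h + z).
    move: fg; rewrite (near_shift 0) subr0.
    by apply: filterS => h /=.
  by apply: filterS2 => h fgh; rewrite !fctE /= fgh.
apply/diff_locallyP; rewrite (diff_unique df1 E).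
by split.
Qed.

Lemma derive_translation f c z v : 'D_v f (c + z) = 'D_v (fun y => f (c + y)) z.
Proof.
rewrite /derive; set a := (fun h => _); set b := (fun h => _).
by suff -> : a = b by []; apply/funext => t; rewrite /a /b /= addrCA.
Qed.

Lemma ndifferentiable_on_sub k U W f : W `<=` U ->
  ndifferentiable_on k U f -> ndifferentiable_on k W f.
Proof.
elim: k f => [|k IH] f WU /=; first by move=> + z /WU; apply.
by move=> [df Df]; split=> [z /WU /df//|v]; apply: IH.
Qed.

(** The condition on a set is a condition at each of its points, because the
   derivatives involved are those of the function on the whole space. *)
Lemma ndifferentiable_on_pointwise k U f :
  (forall z, U z -> ndifferentiable_on k [set z] f) -> ndifferentiable_on k U f.
Proof.
elim: k f => [|k IH] f H /=; first by move=> z /H; apply.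
split=> [z /H [+ _]|v]; first exact.
by apply: IH => z /H [_]; apply.
Qed.

Lemma open_near_eq U f g z : open U -> U z -> (forall z, U z -> f z = g z) ->
  \near z, f z = g z.
Proof.
by move=> oU Uz fg; near=> y; apply: fg; near: y; apply: open_nbhs_nbhs.
Unshelve. all: by end_near. Qed.

Lemma ndifferentiable_on_ext k U f g : open U -> (forall z, U z -> f z = g z) ->
  ndifferentiable_on k U f -> ndifferentiable_on k U g.
Proof.
move=> oU; elim: k f g => [|k IH] f g fg /=.
  move=> cf z Uz; rewrite /prop_for /continuous_at -fg//.
  apply: cvg_trans (cf _ Uz); apply: near_eq_cvg.
  exact: open_near_eq fg.
move=> [df Df]; split=> [z Uz|v].
  by apply: near_eq_differentiable (df _ Uz); apply: open_near_eq fg.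
apply: IH (Df v) => z Uz; apply: near_eq_derive.
exact: open_near_eq fg.
Qed.

Lemma ndifferentiable_onW k U f : ndifferentiable_on k.+1 U f -> ndifferentiable_on k U f.
Proof.
elim: k f => [|k IH] f [df Df] /=.
  by move=> z /df; exact: differentiable_continuous.
by split => // v; apply: IH.
Qed.

Lemma ndifferentiable_on_cst k U (a : R) : ndifferentiable_on k U (cst a).
Proof.
elim: k a => [|k IH] a /=; first by move=> z _; exact: cst_continuous.
split=> [z _|v]; first exact: differentiable_cst.
have -> : 'D_v (cst a : V -> R) = cst 0 by apply/funext => z; rewrite derive_cst.
exact: IH.
Qed.

Lemma ndifferentiable_on_D k U f g : open U -> ndifferentiable_on k U f ->
  ndifferentiable_on k U g -> ndifferentiable_on k U (f + g).
Proof.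
move=> oU; elim: k f g => [|k IH] f g /=.
  by move=> cf cg z Uz; apply: continuousD; [exact: cf|exact: cg].
move=> [df Df] [dg Dg]; split=> [z Uz|v].
  by apply: differentiableD; [exact: df|exact: dg].
apply: (ndifferentiable_on_ext oU _ (IH _ _ (Df v) (Dg v))) => z Uz.
by rewrite deriveD//; apply: diff_derivable; [exact: df|exact: dg].
Qed.

Lemma ndifferentiable_on_M k U f g : open U -> ndifferentiable_on k U f ->
  ndifferentiable_on k U g -> ndifferentiable_on k U (f * g).
Proof.
move=> oU; elim: k f g => [|k IH] f g.
  by move=> cf cg z Uz; apply: continuousM; [exact: cf|exact: cg].
move=> nf ng; have [df Df] := nf; have [dg Dg] := ng.
split=> [z Uz|v].
  by apply: differentiableM; [exact: df|exact: dg].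
have fDg := IH _ _ (ndifferentiable_onW nf) (Dg v).
have gDf := IH _ _ (ndifferentiable_onW ng) (Df v).
apply: (ndifferentiable_on_ext oU _ (ndifferentiable_on_D oU fDg gDf)).
by move=> z Uz; rewrite deriveM//; apply: diff_derivable; [exact: df|exact: dg].
Qed.

End SmoothCalculus.

Section SmoothAt.
Context {R : realType} {V : normedModType R}.
Implicit Types (U : set V) (f g : V -> R) (z v : V).

Lemma smooth_on_at U f z : open U -> smooth_on U f -> U z -> smooth_at z f.
Proof. by move=> oU sf Uz; exists U. Qed.

Lemma smooth_at_on U f : (forall z, U z -> smooth_at z f) -> smooth_on U f.
Proof.
move=> H k; apply: ndifferentiable_on_pointwise => z /H [W [_ Wz] sf].
by apply: ndifferentiable_on_sub (sf k) => _ ->.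
Qed.

Lemma smooth_at_near f z : smooth_at z f -> \near z, smooth_at z f.
Proof.
move=> [U [oU Uz] sf]; near=> y.
by apply: (smooth_on_at oU) => //; near: y; apply: open_nbhs_nbhs.
Unshelve. all: by end_near. Qed.

Lemma smooth_at_ext f g z : (\near z, f z = g z) -> smooth_at z f -> smooth_at z g.
Proof.
move=> fg [U [oU Uz] sf].
have : nbhs z ((fun y => f y = g y) `&` U).
  by apply: filterI => //; apply: open_nbhs_nbhs.
rewrite nbhsE => -[W [oW Wz] WU]; exists W => // k.
apply: (@ndifferentiable_on_ext _ _ _ _ f) => //; first by move=> y /WU [].
by apply: ndifferentiable_on_sub (sf k) => y /WU [].
Qed.

Lemma smooth_at_differentiable f z : smooth_at z f -> differentiable f z.
Proof. by move=> [U [oU Uz] sf]; have [+ _] := sf 1%N; apply. Qed.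

Lemma smooth_at_derivable f z v : smooth_at z f -> derivable f z v.
Proof. by move=> /smooth_at_differentiable; exact: diff_derivable. Qed.

Lemma smooth_at_continuous f z : smooth_at z f -> {for z, continuous f}.
Proof. by move=> [U [oU Uz] sf]; apply: (sf 0%N). Qed.

Lemma smooth_at_derive f z v : smooth_at z f -> smooth_at z ('D_v f).
Proof. by move=> [U oU sf]; exists U => // k; have [_] := sf k.+1; apply. Qed.

Lemma smooth_at_cst (a : R) z : smooth_at z (cst a).
Proof. by exists setT => [|k]; [split=> //; exact: openT|exact: ndifferentiable_on_cst]. Qed.

Lemma smooth_at_D f g z : smooth_at z f -> smooth_at z g -> smooth_at z (f + g).
Proof.
move=> [U [oU Uz] sf] [W [oW Wz] sg]; exists (U `&` W).
  by split=> //; exact: openI.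
move=> k; apply: ndifferentiable_on_D; first exact: openI.
  by apply: ndifferentiable_on_sub (sf k) => ? [].
by apply: ndifferentiable_on_sub (sg k) => ? [].
Qed.

Lemma smooth_at_M f g z : smooth_at z f -> smooth_at z g -> smooth_at z (f * g).
Proof.
move=> [U [oU Uz] sf] [W [oW Wz] sg]; exists (U `&` W).
  by split=> //; exact: openI.
move=> k; apply: ndifferentiable_on_M; first exact: openI.
  by apply: ndifferentiable_on_sub (sf k) => ? [].
by apply: ndifferentiable_on_sub (sg k) => ? [].
Qed.

Lemma smooth_at_N f z : smooth_at z f -> smooth_at z (- f).
Proof.
move=> sf; have := smooth_at_M (smooth_at_cst (-1) z) sf.
by congr smooth_at; apply/funext => y; rewrite /GRing.mul /= mulN1r.
Qed.

Lemma smooth_at_B f g z : smooth_at z f -> smooth_at z g -> smooth_at z (f - g).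
Proof. by move=> sf sg; apply: smooth_at_D sf _; exact: smooth_at_N. Qed.

Lemma smooth_at_sum (I : Type) (r : seq I) (F : I -> V -> R) z :
  (forall i, smooth_at z (F i)) -> smooth_at z (fun y => \sum_(i <- r) F i y).
Proof.
move=> sF; elim: r => [|i r IH].
  have := smooth_at_cst 0 z; congr smooth_at.
  by apply/funext => y; rewrite big_nil.
have := smooth_at_D (sF i) IH; congr smooth_at.
by apply/funext => y; rewrite big_cons.
Qed.

End SmoothAt.

Section SmoothComp.
Context {R : realType} {V W : normedModType R}.
Variable L : {linear W -> V}.

(** No differentiability is needed: the difference quotients coincide. *)
Lemma derive_comp_linear (f : V -> R) (w : W) : 'D_w (f \o L) = 'D_(L w) f \o L.
Proof.
apply/funext => z /=; rewrite /derive.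
set a := (fun h => _); set b := (fun h => _).
suff -> : a = b by []; apply/funext => h; rewrite /a /b /=.
by congr (_ *: (f _ - _)); rewrite linearD; congr (_ + _); exact: linearZZ.
Qed.

Hypothesis cL : continuous L.

Lemma smooth_at_comp (f : V -> R) (z : W) : smooth_at (L z) f -> smooth_at z (f \o L).
Proof.
move=> [U [oU Uz] sf]; exists (L @^-1` U).
  by split=> //; apply: open_comp oU => y _; exact: cL.
move=> k; elim: k f {sf}(sf k) => [|k IH] f.
  move=> cf y Uy; apply: continuous_comp; first exact: cL.
  exact: cf.
move=> [df Df]; split=> [y Uy|w].
  apply: differentiable_comp; last exact: df.
  exact: linear_differentiable.
by rewrite derive_comp_linear; exact: (IH _ (Df _)).
Qed.

End SmoothComp.

(** * Symmetry of second derivatives *)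

Section Schwarz.
Context {R : realType} {V : normedModType R}.
Implicit Types (f : V -> R) (z a b y : V).

(** Mean value theorem along the segment from y to y + h a. *)
Lemma MVT_direction f y a (h : R) : 0 < h ->
  (forall t : R, 0 <= t <= h -> derivable f (t *: a + y) a) ->
  exists2 t, 0 < t < h & f (h *: a + y) - f y = 'D_a f (t *: a + y) * h.
Proof.
move=> h0 df; pose phi t := f (t *: a + y).
have dphi t : 0 <= t <= h -> is_derive t (1 : R) phi ('D_a f (t *: a + y)).
  move=> th; have E : (fun s : R => s^-1 *: ((phi \o shift t) (s *: (1 : R)) - phi t)) =
      (fun s : R => s^-1 *: ((f \o shift (t *: a + y)) (s *: a) - f (t *: a + y))).
    apply/funext => s /=; rewrite /phi; congr (_ *: (f _ - _)).
    by rewrite [s *: 1]mulr1 scalerDl addrA.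
  by split; rewrite /derivable /derive E //; exact: df.
have [||t th] := @MVT R phi (fun t => 'D_a f (t *: a + y)) 0 h h0.
- by move=> t /[!in_itv]/= /andP[t0 th]; apply: dphi; rewrite !ltW.
- apply: derivable_within_continuous => t /[!in_itv]/= th.
  by have [] := dphi t th.
- rewrite /phi scale0r add0r subr0 => E; exists t => //.
Qed.

(** A second difference of f with step h is h^2 times a mixed second
   derivative at some point near z, by two applications of the mean value
   theorem.  The difference is symmetric in a and b, the derivative is taken in
   a chosen order. *)
Lemma second_difference f z a b (P : set V) : smooth_at z f -> (\near z, P z) ->
  \forall h \near (0 : R)^'+, exists2 y, P y &
    f (h *: a + (h *: b + z)) - f (h *: a + z) - f (h *: b + z) + f z
    = 'D_b ('D_a f) y * h * h.
Proof.
move=> /smooth_at_near sf nP.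
have cm : (fun st : R * R => st.1 *: a + (st.2 *: b + z)) @ (0 : R * R)
    --> (0 : R) *: a + ((0 : R) *: b + z).
  apply: cvgD; first by apply: cvgZr_tmp; exact: cvg_fst.
  apply: cvgD; last exact: cvg_cst.
  by apply: cvgZr_tmp; exact: cvg_snd.
rewrite !scale0r !add0r in cm.
have /cm : \near z, P z /\ smooth_at z f by near=> y; split; near: y.
move=> /nbhs_ballP[r /= r0 rP].
have {}rP s t : 0 <= s < r -> 0 <= t < r ->
   P (s *: a + (t *: b + z)) /\ smooth_at (s *: a + (t *: b + z)) f.
  move=> /andP[s0 sr] /andP[t0 tr]; apply: (rP (s, t)).
  by split; rewrite /ball/= sub0r normrN ger0_norm.
near=> h.
have h0 : 0 < h by [].
have hr : h < r by near: h; exact: nbhs_right_lt.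
(* The mean value theorem is applied to g along a, then to 'D_a f along b. *)
pose fs y := f (h *: b + y).
pose g := fs - f.
have shiftd y c : 'D_c fs y = 'D_c f (h *: b + y) by rewrite derive_translation.
have shiftdr y c : derivable f (h *: b + y) c -> derivable fs y c.
  rewrite /derivable; set u := (fun h => _); set v := (fun h => _).
  by suff -> : u = v by []; apply/funext => t; rewrite /u /v /= addrCA.
have fsE y : fs y = f (h *: b + y) by [].
clearbody fs.
have dg t : 0 <= t < r -> derivable f (h *: b + (t *: a + z)) a /\ derivable f (t *: a + z) a.
  move=> tr; split; apply: smooth_at_derivable.
    by rewrite addrCA; apply: (rP _ _ tr _).2; rewrite hr ltW.
  by rewrite -[z in t *: a + z]add0r -(scale0r b); apply: (rP _ _ tr _).2; rewrite lexx r0.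
have [|t /andP[t0 th] E] := @MVT_direction g z a h h0.
  move=> t /andP[t0 th]; have [|d1 d2] := dg t.
    by rewrite t0 (le_lt_trans th).
  by apply: (derivableB (shiftdr _ _ d1) d2).
have tr : 0 <= t < r by rewrite ltW //= (lt_trans th).
have [d1 d2] := dg t tr.
have Dg : 'D_a g (t *: a + z) = 'D_a f (h *: b + (t *: a + z)) - 'D_a f (t *: a + z).
  by rewrite -shiftd; apply: deriveB d2; exact: shiftdr.
have [|s /andP[s0 sh] E'] := @MVT_direction ('D_a f) (t *: a + z) b h h0.
  move=> s /andP[s0 sh]; apply: smooth_at_derivable; apply: smooth_at_derive.
  by rewrite addrCA; apply: (rP _ _ tr _).2; rewrite s0 (le_lt_trans sh).
exists (t *: a + (s *: b + z)).
  by apply: (rP _ _ tr _).1; rewrite ltW //= (lt_trans sh).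
have -> : t *: a + (s *: b + z) = s *: b + (t *: a + z) by rewrite addrCA.
rewrite -E' -Dg -E /g [h *: a + (h *: b + z)]addrCA.
by rewrite !fctE !fsE; ring.
Unshelve. all: by end_near. Qed.

Lemma schwarz f z a b : smooth_at z f ->
  'D_a ('D_b f) z = 'D_b ('D_a f) z.
Proof.
move=> sf; apply/eqP; rewrite -subr_eq0 -normr_le0; apply/ler_addgt0Pl => e e0.
rewrite addr0.
have sab : smooth_at z ('D_a ('D_b f)) by do 2 apply: smooth_at_derive.
have sba : smooth_at z ('D_b ('D_a f)) by do 2 apply: smooth_at_derive.
have e20 : 0 < e / 2 by rewrite divr_gt0.
have /cvgrPdist_lt/(_ _ e20) nab := smooth_at_continuous sab.
have /cvgrPdist_lt/(_ _ e20) nba := smooth_at_continuous sba.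
have H1 := second_difference b a sf nab.
have H2 := second_difference a b sf nba.
suff /filter_ex[//] : \forall h \near (0 : R)^'+, `|'D_a ('D_b f) z - 'D_b ('D_a f) z| <= e.
apply: filterS3 H1 H2 (nbhs_right_gt 0) => h [y1 Py1 E1] [y2 Py2 E2] h0.
move: Py1 E1 Py2 E2.
move: ('D_a ('D_b f) y1) ('D_b ('D_a f) y2) ('D_a ('D_b f) z) ('D_b ('D_a f) z).
move=> d1 d2 d3 d4 Py1 E1 Py2 E2.
have swap : h *: b + (h *: a + z) = h *: a + (h *: b + z) by rewrite addrCA.
have E : d1 * h * h = d2 * h * h by rewrite -E1 -E2 swap; congr (_ + _); exact: addrAC.
have {}E : d1 = d2 by move: E => /mulIf-/(_ (lt0r_neq0 h0))/mulIf-/(_ (lt0r_neq0 h0)).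
rewrite [e]splitr -[X in `|X|](subrKA d1).
apply: le_trans (ler_normD _ _) _; apply: lerD; first exact: ltW.
by rewrite E distrC; exact: ltW.
Qed.

End Schwarz.

(** * The base and the break points *)

Section BaseTopology.
Context {R : realType} {n : nat}.
Implicit Types (p : 'rV[R]_n) (m : 'rV[int]_n) (z : R * 'rV[R]_n).

Lemma latticeE p m i : (p + lattice m) 0 i = p 0 i + (m 0 i)%:~R.
Proof. by rewrite !mxE. Qed.

Lemma coord_lattice_continuous m k :
  continuous (fun q : 'rV[R]_n => (q + lattice m) 0 k).
Proof.
have -> : (fun q : 'rV[R]_n => (q + lattice m) 0 k) =
    (fun q : 'rV[R]_n => q 0 k + (m 0 k)%:~R :> R).
  by apply/funext => q; rewrite latticeE.
move=> q; exact: (cvgD (@coord_continuous R 1 n 0 k q) (cvg_cst _)).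
Qed.

Lemma open_cyc_ordered : open (@cyc_ordered R n).
Proof.
rewrite openE => p [m H]; rewrite /interior.
have Hij : forall ij : 'I_n * 'I_n, \forall q \near p, (ij.1 < ij.2)%N ->
    (q + lattice m) 0 ij.1 < (q + lattice m) 0 ij.2 < (q + lattice m) 0 ij.1 + 1.
  move=> [i j] /=; have [ij|] := boolP (i < j)%N; last by move=> _; near=> q.
  have ci k := @coord_lattice_continuous m k p.
  have /andP[Hl Hr] := H i j ij.
  near=> q => _; apply/andP; split.
    rewrite -subr_gt0; near: q.
    by apply: (cvgr_gt _ (cvgB (ci j) (ci i))); rewrite subr_gt0.
  rewrite -subr_gt0; near: q.
  apply: (cvgr_gt _ (cvgB (cvgD (ci i) (cvg_cst (1 : R))) (ci j))).
  by rewrite subr_gt0.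
apply: filterS (@filter_forall _ _ _ (nbhs p) _ Hij) => q Hq.
by exists m => i j ij; exact: (Hq (i, j)).
Unshelve. all: by end_near. Qed.

(** The points of a tuple in the base are distinct in R/Z. *)
Lemma cyc_ordered_distinct p i j (k : int) : cyc_ordered p ->
  p 0 i = p 0 j + k%:~R -> i = j /\ k = 0.
Proof.
move=> [m H]; wlog ij : i j k / (i <= j)%N.
  move=> W; case/orP: (leq_total i j) => ij; first exact: W.
  move=> E; have [|-> /eqP] := W j i (- k) ij; first by rewrite E rmorphN /= addrK.
  by rewrite oppr_eq0 => /eqP.
move: ij; rewrite leq_eqVlt => /orP[/eqP/val_inj ->|ij E].
  move=> /eqP; rewrite -subr_eq0 opprD addNKr oppr_eq0 intr_eq0 => /eqP ->.
  by [].
exfalso; have /andP[] := H i j ij; rewrite !latticeE E.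
have -> : p 0 j + k%:~R + (m 0 i)%:~R < p 0 j + (m 0 j)%:~R =
    (k + m 0 i < m 0 j).
  by rewrite -(ltr_int R) rmorphD /= -addrA ltrD2l.
have -> : p 0 j + (m 0 j)%:~R < p 0 j + k%:~R + (m 0 i)%:~R + 1 =
    (m 0 j < k + m 0 i + 1).
  by rewrite -(ltr_int R) !rmorphD /= -!addrA ltrD2l.
by rewrite ltzD1 leNgt => ->.
Qed.

(** Integers near r are equal to r. *)
Lemma int_isolated (r : R) :
  \forall s \near r, forall k : int, s = k%:~R -> r = k%:~R.
Proof.
have [[m rm]|rint] := pselect (exists m : int, r = m%:~R).
  near=> s => k sk; rewrite rm; congr (_%:~R); apply/eqP.
  have : ball r 1 s by near: s; exact: nbhsx_ballx.
  rewrite /ball /= rm sk -rmorphB -intr_norm -[1]/(1%:~R) ltr_int.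
  by lia.
near=> s => k sk; exfalso.
have : s < (Num.floor r + 1)%:~R.
  by near: s; apply: lt_nbhsl; exact: floorD1_gt.
have : (Num.floor r)%:~R < s.
  near: s; apply: lt_nbhsr; rewrite lt_neqAle ge_floor andbT.
  by apply/eqP => E; apply: rint; exists (Num.floor r).
by rewrite sk !ltr_int ltzD1 ltNge => /negbTE ->.
Unshelve. all: by end_near. Qed.

(** The hypersurfaces x = p_i + k form a locally finite closed family: those
   that meet a small neighborhood of z pass through z. *)
Lemma breaks_near z : \forall y \near z, forall i (k : int),
  y.1 = (y.2 : 'rV[R]_n) 0 i + k%:~R -> z.1 = (z.2 : 'rV[R]_n) 0 i + k%:~R.
Proof.
suff H : forall i, \forall y \near z, forall k : int,
    y.1 = (y.2 : 'rV[R]_n) 0 i + k%:~R -> z.1 = (z.2 : 'rV[R]_n) 0 i + k%:~R.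
  exact: (@filter_forall _ _ _ (nbhs z) _ H).
move=> i.
have cm : (fun y : R * 'rV[R]_n => y.1 - y.2 0 i) @ z --> z.1 - z.2 0 i.
  have cs : (snd : R * 'rV[R]_n -> 'rV[R]_n) @ z --> z.2 by exact: cvg_snd.
  have c2 := cvg_comp snd (fun q : 'rV[R]_n => q 0 i) cs (@coord_continuous R 1 n 0 i z.2).
  have c1 : (fst : R * 'rV[R]_n -> R) @ z --> z.1 by exact: cvg_fst.
  exact: (cvgB c1 c2).
have H : \forall y \near z, forall k : int, y.1 - (y.2 : 'rV[R]_n) 0 i = k%:~R ->
    z.1 - (z.2 : 'rV[R]_n) 0 i = k%:~R by exact: (cm _ (int_isolated _)).
apply: filterS H => y H k E; apply/eqP; rewrite addrC -subr_eq; apply/eqP.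
by apply: H; rewrite E addrAC subrr add0r.
Qed.

(** The part of R x R^n over the base where x is not a break point. *)
Definition off_breaks : set (R * 'rV[R]_n) :=
  [set z | cyc_ordered z.2 /\ ~ is_break z.2 z.1].

Lemma near_cyc z : cyc_ordered z.2 -> \forall y \near z, cyc_ordered y.2.
Proof.
move=> zB; apply: (@cvg_snd _ _ (nbhs z.1) (nbhs z.2)).
by apply: open_nbhs_nbhs; split=> //; exact: open_cyc_ordered.
Qed.

Lemma near_off_breaks z : off_breaks z -> \forall y \near z, off_breaks y.
Proof.
move=> [zB zN]; apply: filterS2 (near_cyc zB) (breaks_near z) => y yB yz.
by split=> // -[i [k /yz E]]; apply: zN; exists i, k.
Qed.

Lemma open_off_breaks : open off_breaks.
Proof. by rewrite openE => z; exact: near_off_breaks. Qed.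

(** Near (p_i, p) the only hypersurface is x = p_i. *)
Lemma near_break_only p i : cyc_ordered p ->
  \forall z \near (p 0 i, p), is_break z.2 z.1 -> z.1 = (z.2 : 'rV[R]_n) 0 i.
Proof.
move=> pB; apply: filterS (breaks_near (p 0 i, p)) => z H [j [k E]].
have /= /(cyc_ordered_distinct pB) [ij k0] := H _ _ E.
by rewrite E k0 ij addr0.
Qed.

Lemma slice_continuous p : continuous (fun y : R => (y, p) : R * 'rV[R]_n).
Proof. by move=> y; exact: (cvg_pair cvg_id (cvg_cst p)). Qed.

Lemma dnbhs_not_break p (x : R) : \forall y \near x^', ~ is_break p y.
Proof.
have H : \forall y \near x, forall i (k : int),
    y = p 0 i + k%:~R -> x = p 0 i + k%:~R.
  exact: (@slice_continuous p x _ (breaks_near (x, p))).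
rewrite /dnbhs; apply: filterS H => y H yx [i [k E]].
by move/eqP : yx; apply; rewrite E; apply/esym; exact: H E.
Qed.

(** Continuous functions of x that agree off the break points agree. *)
Lemma eq_off_breaks p (f g : R -> R) (x : R) :
  {for x, continuous f} -> {for x, continuous g} ->
  (forall y, ~ is_break p y -> f y = g y) -> f x = g x.
Proof.
move=> cf cg fg.
have f1 : f @ x^' --> f x by exact: cvg_trans (cvg_within_filter _ _) cf.
have g1 : g @ x^' --> g x by exact: cvg_trans (cvg_within_filter _ _) cg.
apply: (cvg_unique _ f1) => //.
apply: cvg_trans g1; apply: near_eq_cvg.
by apply: filterS (dnbhs_not_break p x) => y /fg.
Qed.

Lemma is_break_lattice p m x : is_break (p + lattice m) x <-> is_break p x.
Proof.
split=> -[i [k E]].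
  by exists i, (m 0 i + k); rewrite E latticeE rmorphD /= addrA.
by exists i, (k - m 0 i); rewrite E latticeE rmorphB /=; ring.
Qed.

Lemma is_break_shift p x : is_break p (x + 1) <-> is_break p x.
Proof.
split=> -[i [k E]].
  by exists i, (k - 1); rewrite rmorphB /= addrA -E addrK.
by exists i, (k + 1); rewrite rmorphD /= addrA -E.
Qed.

End BaseTopology.

(** * Derivatives in x and broken vector fields *)

Section SliceDerivatives.
Context {R : realType} {n : nat}.
Implicit Types (p : 'rV[R]_n) (z : R * 'rV[R]_n) (f g u : R * 'rV[R]_n -> R) (w : R -> R).

Lemma slice_line (h x : R) p :
  h *: ((1, 0) : R * 'rV[R]_n) + (x, p) = (h *: (1 : R) + x, p).
Proof.
have -> : h *: ((1, 0) : R * 'rV[R]_n) + (x, p) =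
    (h *: (1 : R) + x, h *: (0 : 'rV[R]_n) + p) by [].
by rewrite scaler0 add0r.
Qed.

Lemma slice_derive f p x : 'D_1 (fun x => f (x, p)) x = dx f (x, p).
Proof.
rewrite /dx /derive; set a := (fun h => _); set b := (fun h => _).
suff -> : a = b by []; apply/funext => h; rewrite /a /b /=; congr (_ *: (f _ - _)).
by rewrite slice_line.
Qed.

Lemma slice_derivable f p x : derivable f (x, p) (1, 0) ->
  derivable (fun x => f (x, p)) x 1.
Proof.
rewrite /derivable; set a := (fun h => _); set b := (fun h => _).
suff -> : a = b by []; apply/funext => h; rewrite /a /b /=; congr (_ *: (f _ - _)).
by rewrite slice_line.
Qed.

(** The derivatives in x of the slice at p are values of the iterated partial
   derivatives.  Derivatives are total functions, so no regularity is needed. *)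
Lemma slice_derive1n k f w p x : (\forall y \near x, w y = f (y, p)) ->
  derive1n k w x = iter k (@dx R n) f (x, p).
Proof.
elim: k x => [|k IH] x wf; first by rewrite derive1n0 /=; exact: nbhs_singleton wf.
rewrite derive1nS derive1E /= -slice_derive; apply: near_eq_derive.
by apply: filterS (near_join wf) => y; exact: IH.
Qed.

Lemma smooth_at_iter_dx k f z : smooth_at z f -> smooth_at z (iter k (@dx R n) f).
Proof. by elim: k => [//|k IH] /IH; exact: smooth_at_derive. Qed.

Lemma difference_quotient_cvg w (a : R) : derivable w a 1 ->
  (w x - w a) / (x - a) @[x --> a^'] --> 'D_1 w a.
Proof.
move=> dw.
have cw : h^-1 *: ((w \o shift a) (h *: (1 : R)) - w a) @[h --> (0 : R)^'] -->
    'D_1 w a by exact: dw.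
have cs : x - a @[x --> a^'] --> (0 : R)^'.
  move=> P /=; rewrite /dnbhs /within /= => P0.
  have cm : (fun x : R => x - a) @ a --> (0 : R).
    by rewrite -(subrr a); apply: cvgB; [exact: cvg_id|exact: cvg_cst].
  have H : \forall x \near a, x - a != 0 -> P (x - a) by exact: (cm _ P0).
  by apply: filterS H => x H xa; apply: H; rewrite subr_eq0.
have := cvg_comp (fun x => x - a) _ cs cw.
apply: cvg_trans; apply: near_eq_cvg; near=> x.
by rewrite /= [_ *: 1]mulr1 subrK [RHS]mulrC.
Unshelve. all: by end_near. Qed.

End SliceDerivatives.

Section Fibers.
Context {R : realType} {n : nat}.
Implicit Types (p : 'rV[R]_n) (w : R -> R).

Lemma dnbhs_left (a : R) (P : set R) : a^' P -> a^'- P.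
Proof.
move=> H; have {}H : \forall y \near a, y != a -> P y by exact: H.
suff : \forall y \near a, y < a -> P y by [].
by apply: filterS H => y + ya; apply; rewrite lt_eqF.
Qed.

Lemma dnbhs_right (a : R) (P : set R) : a^' P -> a^'+ P.
Proof.
move=> H; have {}H : \forall y \near a, y != a -> P y by exact: H.
suff : \forall y \near a, a < y -> P y by [].
by apply: filterS H => y + ya; apply; rewrite gt_eqF.
Qed.

Lemma near_not_break p (x : R) : ~ is_break p x -> \forall y \near x, ~ is_break p y.
Proof.
move=> Nx; have H : \forall y \near x, forall i (k : int),
    y = p 0 i + k%:~R -> x = p 0 i + k%:~R.
  exact: (@slice_continuous _ _ p x _ (breaks_near (x, p))).
by apply: filterS H => y H [i [k /H E]]; apply: Nx; exists i, k.
Qed.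

Lemma derive1n_linear p (a : R) w1 w2 k x :
  (forall (k : nat) x, ~ is_break p x -> derivable (derive1n k w1) x 1) ->
  (forall (k : nat) x, ~ is_break p x -> derivable (derive1n k w2) x 1) ->
  ~ is_break p x ->
  derive1n k (a *: w1 + w2) x = a * derive1n k w1 x + derive1n k w2 x.
Proof.
move=> d1 d2; elim: k x => [|k IH] x Nx; first by rewrite !derive1n0.
rewrite !derive1nS !derive1E.
have E : \forall y \near x, derive1n k (a *: w1 + w2) y =
    (a *: derive1n k w1 + derive1n k w2) y.
  by apply: filterS (near_not_break Nx) => y /IH.
rewrite (near_eq_derive _ E) deriveD ?deriveZ //; first exact: d1.
- by apply: derivableZ; exact: d1.
- exact: d2.
Qed.

Lemma broken_field_linear p (a : R) w1 w2 :
  broken_field p w1 -> broken_field p w2 -> broken_field p (a *: w1 + w2).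
Proof.
move=> [per1 c1 d1 s1] [per2 c2 d2 s2].
split.
- by move=> x; rewrite !fctE per1 per2.
- by move=> x; apply: cvgD; [apply: cvgZl_tmp; exact: c1|exact: c2].
- move=> k x Nx.
  have E : \forall y \near x, (a *: derive1n k w1 + derive1n k w2) y =
    derive1n k (a *: w1 + w2) y.
    by apply: filterS (near_not_break Nx) => y Ny; rewrite (derive1n_linear _ _ d1 d2).
  apply: near_eq_derivable E _; apply: derivableD; last exact: d2.
  by apply: derivableZ; exact: d1.
- have side i (F : set_system R) : Filter F -> (forall P, (p 0 i)^' P -> F P) ->
    one_sided_derivatives w1 (p 0 i) F -> one_sided_derivatives w2 (p 0 i) F ->
    one_sided_derivatives (a *: w1 + w2) (p 0 i) F.
    move=> FF iF [e1 [e10 H1]] [e2 [e20 H2]].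
    exists (fun k => a * e1 k + e2 k); split; first by rewrite e10 e20.
    move=> k /=.
    have H : a * ((derive1n k w1 x - e1 k) / (x - p 0 i)) +
        (derive1n k w2 x - e2 k) / (x - p 0 i) @[x --> F] --> a * e1 k.+1 + e2 k.+1.
      by apply: cvgD (H2 k); apply: cvgM (H1 k); exact: cvg_cst.
    apply: cvg_trans H; apply: near_eq_cvg.
    apply: filterS (iF _ (dnbhs_not_break p (p 0 i))) => x Nx.
    rewrite (derive1n_linear _ _ d1 d2)//.
    by rewrite mulrA -mulrDl; congr (_ / _); ring.
  move=> i; have [l1 r1] := s1 i; have [l2 r2] := s2 i; split.
    by apply: side => // P; exact: dnbhs_left.
  by apply: side => // P; exact: dnbhs_right.
Qed.

Lemma derive1n_zero k : derive1n k (0 : R -> R) = 0.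
Proof.
elim: k => [|k IH]; first exact: derive1n0.
by rewrite derive1nS IH; apply/funext => x; rewrite derive1E derive_cst.
Qed.

Lemma broken_field_zero p : broken_field p (0 : R -> R).
Proof.
have z F : Filter F -> forall a, one_sided_derivatives (0 : R -> R) a F.
  move=> FF a; exists (fun=> 0); split=> // k; rewrite derive1n_zero.
  have -> : (fun x : R => ((0 : R -> R) x - 0) / (x - a)) = cst 0.
    by apply/funext => x; rewrite subr0 mul0r.
  exact: cvg_cst.
split=> //.
- by move=> x; exact: cvg_cst.
- by move=> k x _; rewrite derive1n_zero; exact: derivable_cst.
- by move=> i; split; exact: z.
Qed.

End Fibers.

(** * Smooth sections *)

Section SectionCriterion.
Context {R : realType} {n : nat}.
Implicit Types (p : 'rV[R]_n) (z : R * 'rV[R]_n) (u v g : R * 'rV[R]_n -> R).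

(** On the side r (one of <= and >=) of the hypersurface x = p_i, u is near
   (p_i, p) the restriction of a function smooth on a full neighborhood. *)
Definition side_smooth (r : rel R) (i : 'I_n) u p :=
  exists2 g, smooth_at (p 0 i, p) g &
    \forall z \near (p 0 i, p), r z.1 ((z.2 : 'rV[R]_n) 0 i) -> u z = g z.

Lemma smooth_on_cutP u : smooth_on_cut u <->
  (forall z, off_breaks z -> smooth_at z u) /\
  forall p i, cyc_ordered p -> side_smooth <=%R i u p /\ side_smooth >=%R i u p.
Proof.
split=> -[s1 s2]; split => //.
  by move=> z zN; exact: (smooth_on_at open_off_breaks s1 zN).
exact: smooth_at_on.
Qed.

Lemma periodic_int (w : R -> R) (k : int) x :
  (forall x, w (x + 1) = w x) -> w (x + k%:~R) = w x.
Proof.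
move=> per; have H (m : nat) y : w (y + m%:R) = w y.
  elim: m y => [|m IH] y; first by rewrite addr0.
  by rewrite -natr1 addrA per.
case: k => m; first exact: H.
by rewrite NegzE rmorphN /= -[in RHS](subrK (m.+1%:R) x) H.
Qed.

(** At (p_i, p) the two one-sided extensions agree with u, hence with each
   other; the other lifts of the break point are reached by periodicity. *)
Lemma smooth_section_continuous u z :
  (forall x p, cyc_ordered p -> u (x + 1, p) = u (x, p)) ->
  smooth_on_cut u -> cyc_ordered z.2 -> {for z, continuous u}.
Proof.
move=> per /smooth_on_cutP[s1 s2] zB.
have [[i [k zik]]|zN] := pselect (is_break z.2 z.1); last first.
  exact: smooth_at_continuous (s1 _ (conj zB zN)).
move: z zB zik => [x p] /= pB ->.
have cu : {for (p 0 i, p), continuous u}.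
  have [[g sg ug] [h sh uh]] := s2 p i pB.
  have /= ug0 := nbhs_singleton ug (lexx _).
  have /= uh0 := nbhs_singleton uh (lexx _).
  apply/cvgrPdist_lt => e e0.
  have /cvgrPdist_lt/(_ _ e0) cg := smooth_at_continuous sg.
  have /cvgrPdist_lt/(_ _ e0) ch := smooth_at_continuous sh.
  apply: filterS2 (filterI ug cg) (filterI uh ch) => y [ugy cgy] [uhy chy].
  case/orP: (le_total y.1 (y.2 0 i)) => yi; first by rewrite ugy// ug0.
  by rewrite uhy// uh0.
pose T (y : R * 'rV[R]_n) : R * 'rV[R]_n := (y.1 - k%:~R, y.2).
have cT : T @ (p 0 i + k%:~R, p) --> (p 0 i, p).
  have c1 : (fst : R * 'rV[R]_n -> R) @ (p 0 i + k%:~R, p) --> p 0 i + k%:~R by exact: cvg_fst.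
  have c2 : (snd : R * 'rV[R]_n -> 'rV[R]_n) @ (p 0 i + k%:~R, p) --> p by exact: cvg_snd.
  have c3 : (fun y : R * 'rV[R]_n => y.1 - k%:~R) @ (p 0 i + k%:~R, p) --> p 0 i.
    rewrite -[X in _ --> X](addrK (k%:~R) (p 0 i)).
    exact: (cvgB c1 (cvg_cst (k%:~R : R))).
  exact: (cvg_pair c3 c2).
have uE y q : cyc_ordered q -> u (y + k%:~R, q) = u (y, q).
  by move=> qB; apply: (@periodic_int (fun y => u (y, q))) => t; exact: per.
have H := cvg_comp _ u cT cu.
rewrite /prop_for /continuous_at uE//.
apply: cvg_trans H; apply: near_eq_cvg.
have := @near_cyc R n (p 0 i + k%:~R, p) pB.
apply: filterS => -[y q] /= qB.
by rewrite /T /= -[in RHS](subrK (k%:~R) y) uE.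
Qed.

(** The one-sided derivatives of a slice are the derivatives in x of a
   one-sided smooth extension. *)
Lemma side_smooth_one_sided (r : rel R) (F : set_system R) i u p :
  Filter F ->
  (forall P : set R, (p 0 i)^' P -> F P) ->
  (F (fun x => \forall y \near x, r y (p 0 i))) ->
  r (p 0 i) (p 0 i) ->
  side_smooth r i u p ->
  one_sided_derivatives (fun x => u (x, p)) (p 0 i) F.
Proof.
move=> FF dF rF rr [g sg ug].
have ug' : \forall x \near (p 0 i), r x (p 0 i) -> u (x, p) = g (x, p).
  exact: (@slice_continuous _ _ p _ _ ug).
exists (fun k => iter k (@dx R n) g (p 0 i, p)); split.
  by rewrite /=; apply/esym; exact: (nbhs_singleton ug' rr).
move=> k; have dg : derivable (fun x => iter k (@dx R n) g (x, p)) (p 0 i) 1.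
  by apply: slice_derivable; apply: smooth_at_derivable; exact: smooth_at_iter_dx.
have H := difference_quotient_cvg dg; rewrite slice_derive in H.
have {}H : (iter k (@dx R n) g (x, p) - iter k (@dx R n) g (p 0 i, p)) / (x - p 0 i)
   @[x --> F] --> iter k.+1 (@dx R n) g (p 0 i, p).
  by move=> P /H; exact: dF.
apply: cvg_trans H; apply: near_eq_cvg.
have nF : F (fun x => \forall y \near x, r y (p 0 i) -> u (y, p) = g (y, p)).
  apply: dF; rewrite /dnbhs.
  have H : \forall x \near p 0 i, x != p 0 i ->
      \forall y \near x, r y (p 0 i) -> u (y, p) = g (y, p).
    by apply: filterS (near_join ug').
  exact: H.
apply: filterS2 rF nF => x rx nx.
rewrite (@slice_derive1n R n k g _ p x)//.
by apply: filterS2 rx nx => y ry; apply.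
Qed.

(** Membership in the fiber and continuity are consequences of periodicity and
   smoothness on the cut space. *)
Lemma smooth_section_of_cut u :
  (forall x p, cyc_ordered p -> u (x + 1, p) = u (x, p)) ->
  (forall x p m, cyc_ordered p -> u (x, p + lattice m) = u (x, p)) ->
  smooth_on_cut u -> smooth_section u.
Proof.
move=> per perp su; have cu := smooth_section_continuous per su.
split => //; move=> p pB.
have /smooth_on_cutP[s1 s2] := su.
split.
- by move=> x; exact: per.
- move=> x; have c := @cu (x, p) pB.
  exact: (cvg_comp _ u (@slice_continuous _ _ p x) c).
- move=> k x Nx.
  have E : \forall y \near x, iter k (@dx R n) u (y, p) = derive1n k (fun x => u (x, p)) y.
    by near=> y; apply/esym/slice_derive1n; near=> t.
  apply: near_eq_derivable E _; apply: slice_derivable; apply: smooth_at_derivable.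
  by apply: smooth_at_iter_dx; apply: s1.
- move=> i; have [sl sr] := s2 p i pB; split.
    refine (@side_smooth_one_sided <=%R (p 0 i)^'- i u p _ _ _ (lexx _) sl).
      by move=> P; exact: dnbhs_left.
    suff : \forall x \near p 0 i, x < p 0 i -> \forall y \near x, y <= p 0 i by [].
    by near=> x => xp; exact: lt_le_nbhsl.
  refine (@side_smooth_one_sided >=%R (p 0 i)^'+ i u p _ _ _ (lexx _) sr).
    by move=> P; exact: dnbhs_right.
  suff : \forall x \near p 0 i, p 0 i < x -> \forall y \near x, p 0 i <= y by [].
  by near=> x => xp; exact: lt_le_nbhsr.
Unshelve. all: by end_near. Qed.

Lemma smooth_section_shift u x p : smooth_section u -> cyc_ordered p ->
  u (x + 1, p) = u (x, p).
Proof. by move=> [fu _ _ _] pB; have [+ _ _ _] := fu p pB; apply. Qed.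

Lemma side_smooth_D r i u v p : side_smooth r i u p -> side_smooth r i v p ->
  side_smooth r i (u + v) p.
Proof.
move=> [g sg ug] [h sh vh]; exists (g + h); first exact: smooth_at_D.
by apply: filterS2 ug vh => z ugz vhz rz; rewrite !fctE ugz// vhz.
Qed.

Lemma side_smooth_M r i u (g : R * 'rV[R]_n -> R) p : smooth_at (p 0 i, p) g ->
  side_smooth r i u p -> side_smooth r i (g * u) p.
Proof.
move=> sg [h sh uh]; exists (g * h); first exact: smooth_at_M.
by apply: filterS uh => z uhz rz; rewrite /GRing.mul /= uhz.
Qed.

Lemma smooth_section_D u v :
  smooth_section u -> smooth_section v -> smooth_section (u + v).
Proof.
move=> su sv; have [_ pu _ /smooth_on_cutP[u1 u2]] := su.
have [_ pv _ /smooth_on_cutP[v1 v2]] := sv.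
apply: smooth_section_of_cut.
- by move=> x p pB; rewrite !fctE !smooth_section_shift.
- by move=> x p m pB; rewrite !fctE pu// pv.
- apply/smooth_on_cutP; split=> [z zN|p i pB].
    by apply: smooth_at_D; [exact: u1|exact: v1].
  have [ul ur] := u2 p i pB; have [vl vr] := v2 p i pB.
  by split; exact: side_smooth_D.
Qed.

Lemma smooth_section_zero : smooth_section (0 : R * 'rV[R]_n -> R).
Proof.
apply: smooth_section_of_cut => //; apply/smooth_on_cutP; split=> [z _|p i _].
  exact: smooth_at_cst.
by split; exists 0 => //; [exact: smooth_at_cst|near=> z|exact: smooth_at_cst|near=> z].
Unshelve. all: by end_near. Qed.

Lemma snd_continuous : continuous (snd : R * 'rV[R]_n -> 'rV[R]_n).
Proof. by move=> z; exact: cvg_snd. Qed.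

Lemma smooth_at_base (f : 'rV[R]_n -> R) z :
  smooth_at z.2 f -> smooth_at z (fun y : R * 'rV[R]_n => f y.2).
Proof. by move=> sf; apply: (@smooth_at_comp _ _ _ snd snd_continuous). Qed.

Lemma smooth_funP (f : 'rV[R]_n -> R) p : smooth_fun (@cyc_ordered R n) f ->
  cyc_ordered p -> smooth_at p f.
Proof. by move=> [_ sf] pB; exact: (smooth_on_at open_cyc_ordered sf pB). Qed.

Lemma smooth_section_M f u : smooth_fun (@cyc_ordered R n) f ->
  smooth_section u -> smooth_section (fun z => f z.2 * u z).
Proof.
move=> sf su; have [_ pu _ /smooth_on_cutP[u1 u2]] := su.
apply: smooth_section_of_cut.
- by move=> x p pB /=; rewrite smooth_section_shift.
- by move=> x p m pB /=; rewrite pu// (sf.1 p m pB).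
- apply/smooth_on_cutP; split=> [z zN|p i pB].
    apply: (@smooth_at_M _ _ (fun z => f z.2) u z); last exact: u1.
    by apply: smooth_at_base; apply: smooth_funP => //; exact: zN.1.
  have [ul ur] := u2 p i pB.
  have sfz : smooth_at (p 0 i, p) (fun z : R * 'rV[R]_n => f z.2).
    by apply: smooth_at_base; exact: smooth_funP.
  by split; apply: (@side_smooth_M _ _ u (fun z => f z.2)).
Qed.

Lemma smooth_fun_cst (a : R) : smooth_fun (@cyc_ordered R n) (cst a).
Proof. by split => //; apply: smooth_at_on => p _; exact: smooth_at_cst. Qed.

Lemma smooth_section_linear (a : R) u v :
  smooth_section u -> smooth_section v -> smooth_section (a *: u + v).
Proof.
move=> su; apply: smooth_section_D.
exact: (smooth_section_M (smooth_fun_cst a) su).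
Qed.

End SectionCriterion.

(** * Derivations along a frame *)

Section Commutator.
Context {R : realType} {V : normedModType R} {K : finType}.
Variable E : K -> V.
Implicit Types (a b : K -> V -> R) (f : V -> R) (z : V).

(** The derivative of f along the vector field with components a in the
   family E of constant vector fields. *)
Definition lie_derivative a f : V -> R := fun z => \sum_k a k z * 'D_(E k) f z.

Lemma smooth_at_lie_derivative a f z :
  (forall k, smooth_at z (a k)) -> smooth_at z f -> smooth_at z (lie_derivative a f).
Proof.
move=> sa sf; apply: (@smooth_at_sum _ _ _ _ (fun k y => a k y * 'D_(E k) f y)) => k.
by apply: smooth_at_M => //; exact: smooth_at_derive.
Qed.

Lemma lie_derivative_ext a f g z : (\near z, f z = g z) ->
  lie_derivative a f z = lie_derivative a g z.
Proof. by move=> fg; apply: eq_bigr => k _; rewrite (near_eq_derive _ fg). Qed.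

Lemma lie_derivativeB a f g z : smooth_at z f -> smooth_at z g ->
  lie_derivative a (f - g) z = lie_derivative a f z - lie_derivative a g z.
Proof.
move=> sf sg; rewrite /lie_derivative -sumrB; apply: eq_bigr => k _.
by rewrite deriveB ?mulrBr//; exact: smooth_at_derivable.
Qed.

Lemma lie_derivativeM a f g z : smooth_at z f -> smooth_at z g ->
  lie_derivative a (f * g) z = f z * lie_derivative a g z + g z * lie_derivative a f z.
Proof.
move=> sf sg; rewrite /lie_derivative !mulr_sumr -big_split; apply: eq_bigr => k _ /=.
have df : derivable f z (E k) := smooth_at_derivable sf.
have dg : derivable g z (E k) := smooth_at_derivable sg.
by rewrite (deriveM df dg) /GRing.scale /=; ring.
Qed.

Lemma derive_lie_derivative a f z v :
  (forall k, smooth_at z (a k)) -> smooth_at z f ->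
  'D_v (lie_derivative a f) z =
    \sum_k ('D_v (a k) z * 'D_(E k) f z + a k z * 'D_v ('D_(E k) f) z).
Proof.
move=> sa sf.
have dk k : is_derive z v (a k * 'D_(E k) f)
    ('D_v (a k) z * 'D_(E k) f z + a k z * 'D_v ('D_(E k) f) z).
  have d1 : derivable (a k) z v := smooth_at_derivable (sa k).
  have d2 : derivable ('D_(E k) f) z v := smooth_at_derivable (smooth_at_derive (E k) sf).
  split; first exact: (derivableM d1 d2).
  by rewrite (deriveM d1 d2) /GRing.scale /= addrC; congr (_ + _); rewrite mulrC.
rewrite /lie_derivative.
suff [_ ->] : is_derive z v (fun y => \sum_k a k y * 'D_(E k) f y)
  (\sum_k ('D_v (a k) z * 'D_(E k) f z + a k z * 'D_v ('D_(E k) f) z)) by [].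
elim: (index_enum K) => [|k r IH].
  have -> : (fun y => \sum_(k <- [::]) a k y * 'D_(E k) f y) = cst 0.
    by apply/funext => y; rewrite big_nil.
  by rewrite big_nil; exact: is_derive_cst.
have -> : (fun y => \sum_(l <- k :: r) a l y * 'D_(E l) f y) =
    a k * 'D_(E k) f + (fun y => \sum_(l <- r) a l y * 'D_(E l) f y).
  by apply/funext => y; rewrite big_cons.
by rewrite big_cons; exact: is_deriveD.
Qed.

(** The commutator of two derivations along a constant frame has no second
   order part, as second derivatives are symmetric. *)
Lemma lie_derivative_commutator a b f z :
  (forall k, smooth_at z (a k)) -> (forall k, smooth_at z (b k)) ->
  smooth_at z f ->
  lie_derivative a (lie_derivative b f) z - lie_derivative b (lie_derivative a f) z =
  \sum_k (lie_derivative a (b k) z - lie_derivative b (a k) z) * 'D_(E k) f z.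
Proof.
move=> sa sb sf.
have expand c d : (forall k, smooth_at z (c k)) -> (forall k, smooth_at z (d k)) ->
   lie_derivative c (lie_derivative d f) z =
   \sum_k lie_derivative c (d k) z * 'D_(E k) f z +
   \sum_l \sum_k c k z * d l z * 'D_(E k) ('D_(E l) f) z.
  move=> sc sd; rewrite {1}/lie_derivative.
  under eq_bigr do rewrite derive_lie_derivative// mulr_sumr.
  rewrite exchange_big -big_split /=; apply: eq_bigr => l _.
  rewrite /lie_derivative mulr_suml -big_split /=; apply: eq_bigr => k _.
  by rewrite mulrDr !mulrA.
rewrite !expand// [X in _ + X - _]exchange_big /=.
rewrite [X in _ + X - _](_ : _ =
  \sum_l \sum_k b k z * a l z * 'D_(E k) ('D_(E l) f) z); last first.
  apply: eq_bigr => k _; apply: eq_bigr => l _.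
  by rewrite schwarz// [a k z * _]mulrC.
under [RHS]eq_bigr do rewrite mulrBl.
by rewrite sumrB; ring.
Qed.

End Commutator.

(** * Values at the break points and the lifted vector field *)

Section Frame.
Context {R : realType} {n : nat}.
Implicit Types (p q : 'rV[R]_n) (z : R * 'rV[R]_n) (u v f g h : R * 'rV[R]_n -> R).

(** The point (p_i, p) of the i-th hypersurface, as a linear map of p. *)
Definition break_point (i : 'I_n) p : R * 'rV[R]_n := (p 0 i, p).

Fact break_point_linear i : linear (break_point i).
Proof. by move=> a p q; rewrite /break_point !mxE. Qed.

HB.instance Definition _ i := GRing.isLinear.Build R 'rV[R]_n (R * 'rV[R]_n)%type _
  (break_point i) (break_point_linear i).

Lemma break_point_continuous i : continuous (break_point i).
Proof. by move=> p; exact: (cvg_pair (@coord_continuous R 1 n 0 i p) cvg_id). Qed.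

(** The value u(p_i, p) at the i-th break point, as a function of p. *)
Definition break_value (i : 'I_n) u : 'rV[R]_n -> R := fun p => u (break_point i p).

(** The vector field # u on the base. *)
Definition anchor_field u p : 'rV[R]_n := broken_anchor p (fun x => u (x, p)).

Lemma anchor_fieldE u p i : anchor_field u p 0 i = break_value i u p.
Proof. by rewrite mxE. Qed.

(** Functions that agree on a closed side of x = p_i have the same values
   on x = p_i; this is where the side being closed matters. *)
Lemma near_break_value (r : rel R) u g i p : reflexive r ->
  (\forall z \near break_point i p, r z.1 ((z.2 : 'rV[R]_n) 0 i) -> u z = g z) ->
  \forall q \near p, break_value i u q = break_value i g q.
Proof.
move=> rr ug.
have H : \forall q \near p, r ((q : 'rV[R]_n) 0 i) ((q : 'rV[R]_n) 0 i) ->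
    u (break_point i q) = g (break_point i q).
  exact: (@break_point_continuous i p _ ug).
by apply: filterS H => q; apply.
Qed.

Lemma smooth_at_break_value i g p :
  smooth_at (break_point i p) g -> smooth_at p (break_value i g).
Proof. by move=> sg; exact: (smooth_at_comp (@break_point_continuous i) sg). Qed.

Lemma derive_break_value i g p q :
  'D_q (break_value i g) p = 'D_(break_point i q) g (break_point i p).
Proof. exact: (congr1 (fun F => F p) (derive_comp_linear (break_point i) g q)). Qed.

Lemma derive_base (f : 'rV[R]_n -> R) z w :
  'D_w (fun y : R * 'rV[R]_n => f y.2) z = 'D_(w.2) f z.2.
Proof.
exact: (congr1 (fun F => F z) (@derive_comp_linear _ _ _ snd f w)).
Qed.

Lemma smooth_section_break_value i u p : smooth_section u -> cyc_ordered p ->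
  smooth_at p (break_value i u).
Proof.
move=> [_ _ _ /smooth_on_cutP[_ s2]] pB; have [[g sg ug] _] := s2 p i pB.
apply: smooth_at_ext (smooth_at_break_value sg).
by apply: filterS (near_break_value (@lexx _ _) ug) => q ->.
Qed.

Lemma smooth_section_off u z : smooth_section u -> off_breaks z -> smooth_at z u.
Proof. by move=> [_ _ _ /smooth_on_cutP[+ _]]; apply. Qed.

Lemma derive_field f z (a : R) q : differentiable f z ->
  'D_(a, q) f z = a * dx f z + \sum_j q 0 j * dp j f z.
Proof.
move=> df; rewrite /dx !deriveE//.
under eq_bigr do rewrite /dp deriveE//.
have dec : (a, q) = a *: ((1, 0) : R * 'rV[R]_n) +
    \sum_j q 0 j *: ((0, delta_mx 0 j) : R * 'rV[R]_n).
  rewrite [RHS]surjective_pairing; congr (_, _).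
    rewrite (raddfD (fst : {additive (R * 'rV[R]_n)%type -> R})).
    rewrite (raddf_sum (fst : {additive (R * 'rV[R]_n)%type -> R})) /=.
    rewrite big1 ?addr0; first exact/esym/mulr1.
    by move=> j _; rewrite /GRing.scale /= mulr0.
  rewrite (raddfD (snd : {additive (R * 'rV[R]_n)%type -> 'rV[R]_n})).
  rewrite (raddf_sum (snd : {additive (R * 'rV[R]_n)%type -> 'rV[R]_n})) /=.
  by rewrite scaler0 add0r; exact: row_sum_delta.
rewrite {1}dec linearD; congr (_ + _); first exact: linearZZ.
rewrite linear_sum; apply: eq_bigr => j _; exact: linearZZ.
Qed.

(** The constant frame of R x R^n: None stands for d/dx and Some i for d/dp_i. *)
Definition frame (k : option 'I_n) : R * 'rV[R]_n :=
  if k is Some i then (0, delta_mx 0 i) else (1, 0).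

(** The components of the vector field g d/dx + sum_i u(p_i, p) d/dp_i.  For
   g = u this is the lift X_u of the section u; near a break point g is a smooth
   extension of u from one side. *)
Definition components u g (k : option 'I_n) z : R :=
  if k is Some i then break_value i u z.2 else g z.

Lemma lie_derivativeE u g f z : differentiable f z ->
  lie_derivative frame (components u g) f z = 'D_(g z, anchor_field u z.2) f z.
Proof.
move=> df; rewrite derive_field// /lie_derivative (bigD1 None)//=; congr (_ + _).
rewrite (reindex_omap Some id) /=; last by case.
by apply: eq_big => [j|j _]; rewrite ?eqxx ?anchor_fieldE.
Qed.

Lemma bracket_formulaE u v z : differentiable u z -> differentiable v z ->
  bracket_formula u v z =
  lie_derivative frame (components u u) v z - lie_derivative frame (components v v) u z.
Proof.
move=> du dv; rewrite !lie_derivativeE// !derive_field// /bracket_formula.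
rewrite sumrB opprD addrACA; congr (_ + _ + (_ - _)).
  by apply: eq_bigr => j _; rewrite anchor_fieldE.
by apply: eq_bigr => j _; rewrite anchor_fieldE.
Qed.

Lemma smooth_at_components u g k z : smooth_section u -> cyc_ordered z.2 ->
  smooth_at z g -> smooth_at z (components u g k).
Proof.
move=> su zB sz; case: k => [i|//].
by apply: (@smooth_at_base _ _ (break_value i u)); exact: smooth_section_break_value.
Qed.

End Frame.

(** * The bracket of two smooth sections *)

Section Bracket.
Context {R : realType} {n : nat}.
Implicit Types (p q : 'rV[R]_n) (z : R * 'rV[R]_n) (u v f g h : R * 'rV[R]_n -> R).

(** The derivative of v(p_i, p) along # u minus that of u(p_i, p) along # v. *)
Definition break_value_bracket (i : 'I_n) u v p : R :=
  'D_(anchor_field u p) (break_value i v) p - 'D_(anchor_field v p) (break_value i u) p.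

(** The bracket formula with u and v replaced, except in their values at the
   break points, by smooth extensions g and h. *)
Definition extended_bracket u v g h : R * 'rV[R]_n -> R :=
  lie_derivative frame (components u g) h - lie_derivative frame (components v h) g.

Lemma smooth_at_extended_bracket u v g h z :
  smooth_section u -> smooth_section v -> cyc_ordered z.2 ->
  smooth_at z g -> smooth_at z h -> smooth_at z (extended_bracket u v g h).
Proof.
move=> su sv zB sg sh; apply: smooth_at_B; apply: smooth_at_lie_derivative => // k.
  exact: smooth_at_components.
exact: smooth_at_components.
Qed.

(** Only the germs of u and v matter, so they may be replaced by extensions. *)
Lemma lie_derivative_near u v g h z : (\near z, u z = g z) -> (\near z, v z = h z) ->
  lie_derivative frame (components u u) v z = lie_derivative frame (components u g) h z.
Proof.
move=> ug vh; rewrite (lie_derivative_ext _ _ vh) /lie_derivative.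
by apply: eq_bigr => -[i|] _ //=; rewrite (nbhs_singleton ug).
Qed.

(** The vector field g d/dx + sum_i u(p_i, p) d/dp_i is tangent to x = p_i where
   g = u. *)
Lemma lie_derivative_on_break_point i u v g h q :
  differentiable h (break_point i q) -> break_value i u q = break_value i g q ->
  (\forall q \near q, break_value i v q = break_value i h q) ->
  lie_derivative frame (components u g) h (break_point i q) =
  'D_(anchor_field u q) (break_value i v) q.
Proof.
move=> dh ug vh; rewrite lie_derivativeE// (near_eq_derive _ vh) derive_break_value.
by rewrite /break_point /= anchor_fieldE ug.
Qed.

(** Here r is a closed side of x = p_i and s its interior, which is open and
   depends only on the sign of x - p_i. *)
Lemma extended_bracket_agrees (r s : rel R) i u v g h p :
  reflexive r -> (forall x y, s x y -> r x y) ->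
  (forall x y : R, s x y -> \forall t \near (x - y), s t 0) ->
  (forall x y : R, s x y = s (x - y) 0) ->
  smooth_at (break_point i p) g -> smooth_at (break_point i p) h ->
  (\forall z \near break_point i p, r z.1 ((z.2 : 'rV[R]_n) 0 i) -> u z = g z) ->
  (\forall z \near break_point i p, r z.1 ((z.2 : 'rV[R]_n) 0 i) -> v z = h z) ->
  (\forall z \near break_point i p, s z.1 ((z.2 : 'rV[R]_n) 0 i) ->
     bracket_formula u v z = extended_bracket u v g h z) /\
  (\forall z \near break_point i p, z.1 = (z.2 : 'rV[R]_n) 0 i ->
     extended_bracket u v g h z = break_value_bracket i u v z.2).
Proof.
move=> rr sr so sB sg sh ug vh; split.
  near=> z => sz.
  have zs : \forall y \near z, s y.1 ((y.2 : 'rV[R]_n) 0 i).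
    have c1 : (fst : R * 'rV[R]_n -> R) @ z --> z.1 by exact: cvg_fst.
    have cs : (snd : R * 'rV[R]_n -> 'rV[R]_n) @ z --> z.2 by exact: cvg_snd.
    have c2 := cvg_comp snd (fun q : 'rV[R]_n => q 0 i) cs (@coord_continuous R 1 n 0 i z.2).
    have H : \forall y \near z, s (y.1 - (y.2 : 'rV[R]_n) 0 i) 0.
      exact: (cvgB c1 c2 (so _ _ sz)).
    by apply: filterS H => y; rewrite -sB.
  have uz : \forall y \near z, u y = g y.
    have H : \forall y \near z, r y.1 ((y.2 : 'rV[R]_n) 0 i) -> u y = g y.
      by near: z; exact: near_join ug.
    by apply: filterS2 zs H => y /sr ry; apply.
  have vz : \forall y \near z, v y = h y.
    have H : \forall y \near z, r y.1 ((y.2 : 'rV[R]_n) 0 i) -> v y = h y.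
      by near: z; exact: near_join vh.
    by apply: filterS2 zs H => y /sr ry; apply.
  have gz : smooth_at z g by near: z; exact: (smooth_at_near sg).
  have hz : smooth_at z h by near: z; exact: (smooth_at_near sh).
  have gu : \forall y \near z, g y = u y by apply: filterS uz => y ->.
  have hv : \forall y \near z, h y = v y by apply: filterS vz => y ->.
  rewrite bracket_formulaE; last 2 first.
  - exact: smooth_at_differentiable (smooth_at_ext gu gz).
  - exact: smooth_at_differentiable (smooth_at_ext hv hz).
  by rewrite (lie_derivative_near uz vz) (lie_derivative_near vz uz).
near=> z => zi.
have zE : z = break_point i z.2 by rewrite /break_point -zi -surjective_pairing.
have uz : \forall q \near z.2, break_value i u q = break_value i g q.
  apply: (@near_break_value _ _ r) => //; rewrite -zE.
  by near: z; exact: near_join ug.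
have vz : \forall q \near z.2, break_value i v q = break_value i h q.
  apply: (@near_break_value _ _ r) => //; rewrite -zE.
  by near: z; exact: near_join vh.
have gz : differentiable g z.
  by apply: smooth_at_differentiable; near: z; exact: (smooth_at_near sg).
have hz : differentiable h z.
  by apply: smooth_at_differentiable; near: z; exact: (smooth_at_near sh).
rewrite /extended_bracket /break_value_bracket !fctE zE /=; rewrite zE in gz hz.
congr (_ - _); apply: lie_derivative_on_break_point => //.
  exact: nbhs_singleton uz.
exact: nbhs_singleton vz.
Unshelve. all: by end_near. Qed.

Lemma lt_side (x y : R) : x < y -> \forall t \near (x - y), t < 0.
Proof. by move=> xy; apply: lt_nbhsl; rewrite subr_lt0. Qed.

Lemma gt_side (x y : R) : x > y -> \forall t \near (x - y), t > 0.
Proof. by move=> xy; apply: lt_nbhsr; rewrite subr_gt0. Qed.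

(** On the open side s of x = p_i the bracket formula has, near (p_i, p), a smooth
   extension, with the prescribed values on x = p_i. *)
Definition bracket_extends (s : rel R) i u v p :=
  exists2 G, smooth_at (break_point i p) G &
    (\forall z \near break_point i p, s z.1 ((z.2 : 'rV[R]_n) 0 i) ->
       bracket_formula u v z = G z) /\
    (\forall z \near break_point i p, z.1 = (z.2 : 'rV[R]_n) 0 i ->
       G z = break_value_bracket i u v z.2).

Lemma bracket_formula_extends u v i p :
  smooth_section u -> smooth_section v -> cyc_ordered p ->
  bracket_extends <%R i u v p /\ bracket_extends >%R i u v p.
Proof.
move=> su sv pB.
have [_ _ _ /smooth_on_cutP[_ u2]] := su; have [_ _ _ /smooth_on_cutP[_ v2]] := sv.
have [[ul sul eul] [ur sur eur]] := u2 p i pB.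
have [[vl svl evl] [vr svr evr]] := v2 p i pB.
split.
  exists (extended_bracket u v ul vl); first exact: smooth_at_extended_bracket.
  apply: (@extended_bracket_agrees <=%R <%R) => //.
  - by move=> x y /ltW.
  - exact: lt_side.
  - by move=> x y; rewrite subr_lt0.
exists (extended_bracket u v ur vr); first exact: smooth_at_extended_bracket.
apply: (@extended_bracket_agrees >=%R >%R) => //.
- by move=> x; exact: lexx.
- by move=> x y /ltW.
- exact: gt_side.
- by move=> x y /=; rewrite subr_gt0.
Qed.

(** The two one-sided limits of the bracket formula at a break point agree. *)
Lemma bracket_formula_cvg u v i p : smooth_section u -> smooth_section v ->
  cyc_ordered p ->
  bracket_formula u v (x, p) @[x --> (p 0 i)^'] --> break_value_bracket i u v p.
Proof.
move=> su sv pB; have [[G sG [G1 G2]] [H sH [H1 H2]]] := bracket_formula_extends i su sv pB.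
have cG := smooth_at_continuous sG; have cH := smooth_at_continuous sH.
have sl := @slice_continuous _ _ p (p 0 i).
have /= G0 := nbhs_singleton G2 erefl; have /= H0 := nbhs_singleton H2 erefl.
apply: (@cvg_at_right_left_dnbhs _ R^o).
  have c : H (x, p) @[x --> (p 0 i)^'+] --> H (p 0 i, p).
    by apply: cvg_at_right_filter; exact: (cvg_comp _ H sl cH).
  rewrite -H0; apply: cvg_trans c; apply: near_eq_cvg.
  suff : \forall x \near p 0 i, p 0 i < x -> H (x, p) = bracket_formula u v (x, p) by [].
  have e : \forall x \near p 0 i, p 0 i < x -> bracket_formula u v (x, p) = H (x, p).
    exact: (sl _ H1).
  by apply: filterS e => x e px; rewrite e.
have c : G (x, p) @[x --> (p 0 i)^'-] --> G (p 0 i, p).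
  by apply: cvg_at_left_filter; exact: (cvg_comp _ G sl cG).
rewrite -G0; apply: cvg_trans c; apply: near_eq_cvg.
suff : \forall x \near p 0 i, x < p 0 i -> G (x, p) = bracket_formula u v (x, p) by [].
have e : \forall x \near p 0 i, x < p 0 i -> bracket_formula u v (x, p) = G (x, p).
  exact: (sl _ G1).
by apply: filterS e => x e px; rewrite e.
Qed.

Lemma broken_bracket_off u v z : ~ is_break z.2 z.1 ->
  broken_bracket u v z = bracket_formula u v z.
Proof. by move=> zN; rewrite /broken_bracket asboolF. Qed.

(** The anchor takes the bracket of sections to the commutator of vector
   fields on the base. *)
Lemma break_value_broken_bracket u v i p : smooth_section u -> smooth_section v ->
  cyc_ordered p -> broken_bracket u v (break_point i p) = break_value_bracket i u v p.
Proof.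
move=> su sv pB; rewrite /broken_bracket asboolT; last by exists i, 0; rewrite addr0.
by apply: cvg_lim => //; exact: bracket_formula_cvg.
Qed.

Lemma broken_bracket_side (r s : rel R) u v i p : smooth_section u -> smooth_section v ->
  cyc_ordered p -> (forall x y, r x y -> s x y \/ x = y) -> irreflexive s ->
  bracket_extends s i u v p ->
  side_smooth r i (broken_bracket u v) p.
Proof.
move=> su sv pB rs si [G sG [G1 G2]]; exists G => //.
have nB := @near_cyc R n (break_point i p) pB.
have nb := near_break_only i pB.
apply: filterS2 (filterI nB nb) (filterI G1 G2) => z [zB zb] [z1 z2] rz.
case: (rs _ _ rz) => [sz|zi].
  rewrite broken_bracket_off ?z1// => /zb zi.
  by move: sz; rewrite zi si.
have zE : z = break_point i z.2 by rewrite /break_point -zi -surjective_pairing.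
by rewrite z2// [in LHS]zE break_value_broken_bracket.
Qed.

Lemma smooth_at_bracket_off u v z : smooth_section u -> smooth_section v ->
  off_breaks z -> smooth_at z (broken_bracket u v) /\
  \near z, broken_bracket u v z =
    (lie_derivative frame (components u u) v - lie_derivative frame (components v v) u) z.
Proof.
move=> su sv zN.
have E : \near z, broken_bracket u v z = extended_bracket u v u v z.
  have := near_off_breaks zN; apply: filterS => y yN.
  rewrite broken_bracket_off; last exact: yN.2.
  rewrite bracket_formulaE//; apply: smooth_at_differentiable; exact: smooth_section_off.
split=> //; apply: smooth_at_ext (smooth_at_extended_bracket su sv zN.1 _ _).
- by apply: filterS E => y ->.
- exact: smooth_section_off.
- exact: smooth_section_off.
Qed.

Lemma derive_shift1 u x p : (forall x q, cyc_ordered q -> u (x + 1, q) = u (x, q)) ->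
  cyc_ordered p -> forall w, 'D_w u (x + 1, p) = 'D_w u (x, p).
Proof.
move=> per pB w.
have E y q : ((y + 1, q) : R * 'rV[R]_n) = (1, 0) + (y, q).
  by rewrite -[RHS]/(1 + y, 0 + q) add0r addrC.
rewrite E derive_translation.
apply: near_eq_derive; apply: filterS (@near_cyc R n (x, p) pB) => -[y q] /= qB.
by rewrite -E; exact: per.
Qed.

Lemma derive_lattice u x p m :
  (forall x q, cyc_ordered q -> u (x, q + lattice m) = u (x, q)) ->
  cyc_ordered p -> forall w, 'D_w u (x, p + lattice m) = 'D_w u (x, p).
Proof.
move=> per pB w.
have E y q : ((y, q + lattice m) : R * 'rV[R]_n) = (0, lattice m) + (y, q).
  by rewrite -[RHS]/(0 + y, lattice m + q) add0r addrC.
rewrite E derive_translation.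
apply: near_eq_derive; apply: filterS (@near_cyc R n (x, p) pB) => -[y q] /= qB.
by rewrite -E; exact: per.
Qed.

Lemma break_value_lattice u i p m : smooth_section u -> cyc_ordered p ->
  break_value i u (p + lattice m) = break_value i u p.
Proof.
move=> su pB; have [_ pu _ _] := su; rewrite /break_value /break_point latticeE pu//.
by apply: (@periodic_int _ (fun y => u (y, p))) => t; exact: smooth_section_shift.
Qed.

Lemma bracket_formula_congr u v z z' :
  (forall w, 'D_w u z = 'D_w u z') -> (forall w, 'D_w v z = 'D_w v z') ->
  u z = u z' -> v z = v z' ->
  (forall i, break_value i u z.2 = break_value i u z'.2) ->
  (forall i, break_value i v z.2 = break_value i v z'.2) ->
  bracket_formula u v z = bracket_formula u v z'.
Proof.
rewrite /bracket_formula /dx /dp => Du Dv -> -> tu tv.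
rewrite Du Dv; congr (_ + _); apply: eq_bigr => j _.
by rewrite Du Dv; congr (_ * _ - _ * _); [exact: tu|exact: tv].
Qed.

Lemma bracket_formula_shift u v x p : smooth_section u -> smooth_section v ->
  cyc_ordered p -> bracket_formula u v (x + 1, p) = bracket_formula u v (x, p).
Proof.
move=> su sv pB.
have uper y q := @smooth_section_shift _ _ u y q su.
have vper y q := @smooth_section_shift _ _ v y q sv.
apply: bracket_formula_congr => //; first exact: derive_shift1.
- exact: derive_shift1.
- exact: uper.
- exact: vper.
Qed.

Lemma bracket_formula_lattice u v x p m : smooth_section u -> smooth_section v ->
  cyc_ordered p -> bracket_formula u v (x, p + lattice m) = bracket_formula u v (x, p).
Proof.
move=> su sv pB; have [_ pu _ _] := su; have [_ pv _ _] := sv.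
apply: bracket_formula_congr.
- by apply: derive_lattice => // y q; exact: pu.
- by apply: derive_lattice => // y q; exact: pv.
- exact: pu.
- exact: pv.
- by move=> i; exact: break_value_lattice.
- by move=> i; exact: break_value_lattice.
Qed.

Lemma dnbhs_shift (f : R -> R) (a : R) : f x @[x --> (a + 1)^'] = f (x + 1) @[x --> a^'].
Proof.
apply/funext => P.
have E : (\forall x \near a + 1, x != a + 1 -> P (f x)) =
    (\forall x \near a, x != a -> P (f (x + 1))).
  rewrite (near_shift a) /=; congr nbhs; apply/funext => x.
  by rewrite /= (_ : a + 1 - a = 1) ?(inj_eq (addIr 1))// addrAC subrr add0r.
exact: E.
Qed.

Lemma smooth_section_bracket u v : smooth_section u -> smooth_section v ->
  smooth_section (broken_bracket u v).
Proof.
move=> su sv; apply: smooth_section_of_cut.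
- move=> x p pB; rewrite /broken_bracket (asbool_equiv_eq (is_break_shift p x)).
  pose F y := bracket_formula u v (y, p).
  have F1 y : F (y + 1) = F y by exact: bracket_formula_shift.
  have E : F y @[y --> (x + 1)^'] = F y @[y --> x^'].
    have FE : (fun y => F (y + 1)) = F by apply/funext.
    exact: etrans (dnbhs_shift F x) (congr1 (fun H : R -> R => H y @[y --> x^']) FE).
  by case: ifP => _; [exact: (congr1 (fun G => lim G) E)|exact: F1].
- move=> x p m pB; rewrite /broken_bracket (asbool_equiv_eq (is_break_lattice p m x)).
  have E : (fun y => bracket_formula u v (y, p + lattice m)) =
      (fun y => bracket_formula u v (y, p)).
    by apply/funext => y; exact: bracket_formula_lattice.
  by case: ifP => _; [exact: (congr1 (fun F => lim (F y @[y --> x^'])) E)|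
    exact: bracket_formula_lattice].
- apply/smooth_on_cutP; split=> [z zN|p i pB].
    by have [] := smooth_at_bracket_off su sv zN.
  have [L Rt] := bracket_formula_extends i su sv pB; split.
    refine (@broken_bracket_side _ <%R u v i p su sv pB _ (@ltxx _ _) L).
    by move=> x y; rewrite le_eqVlt => /orP[/eqP|]; [right|left].
  refine (@broken_bracket_side _ >%R u v i p su sv pB _ (@ltxx _ _) Rt).
  by move=> x y /=; rewrite le_eqVlt => /orP[/eqP|]; [right|left].
Qed.

End Bracket.

(** * Algebraic identities of the bracket *)

Section Identities.
Context {R : realType} {n : nat}.
Implicit Types (p q : 'rV[R]_n) (z : R * 'rV[R]_n) (u v w : R * 'rV[R]_n -> R).

Local Notation B := (@cyc_ordered R n).
(* The derivation X_u. *)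
Local Notation LX u := (lie_derivative frame (components u u)).

Lemma smooth_section_slice u p x : smooth_section u -> cyc_ordered p ->
  {for x, continuous (fun x => u (x, p))}.
Proof. by move=> [fu _ _ _] pB; have [_ + _ _] := fu p pB; apply. Qed.

(** Sections that agree off the break points agree over the base. *)
Lemma smooth_section_eq u v : smooth_section u -> smooth_section v ->
  (forall z, off_breaks z -> u z = v z) -> eq_over B u v.
Proof.
move=> su sv uv x p pB.
apply: (@eq_off_breaks _ _ p (fun x => u (x, p)) (fun x => v (x, p))).
- exact: smooth_section_slice.
- exact: smooth_section_slice.
- by move=> y yN; exact: uv.
Qed.

Lemma smooth_section_N u : smooth_section u -> smooth_section (- u).
Proof.
move=> su; have := smooth_section_linear (-1) su smooth_section_zero.
by rewrite scaleN1r addr0.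
Qed.

Lemma bracket_formula_antisym u v z : bracket_formula u v z = - bracket_formula v u z.
Proof.
rewrite /bracket_formula opprD opprB; congr (_ + _).
by rewrite -[RHS]sumrN; apply: eq_bigr => j _; rewrite opprB.
Qed.

Lemma broken_bracket_antisym u v : smooth_section u -> smooth_section v ->
  eq_over B (broken_bracket u v) (- broken_bracket v u).
Proof.
move=> su sv; apply: smooth_section_eq.
- exact: smooth_section_bracket.
- by apply: smooth_section_N; exact: smooth_section_bracket.
- move=> z [_ zN]; rewrite !fctE !broken_bracket_off//.
  exact: bracket_formula_antisym.
Qed.

Lemma broken_bracket_ext u u' v v' : eq_over B u u' -> eq_over B v v' ->
  eq_over B (broken_bracket u v) (broken_bracket u' v').
Proof.
move=> uu vv x p pB.
have E : (fun y => bracket_formula u v (y, p)) = (fun y => bracket_formula u' v' (y, p)).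
  apply/funext => y; rewrite /bracket_formula /dx /dp /=.
  have nB := @near_cyc R n (y, p) pB.
  have nu : \forall z \near (y, p), u z = u' z by apply: filterS nB => -[a q] /uu.
  have nv : \forall z \near (y, p), v z = v' z by apply: filterS nB => -[a q] /vv.
  have Du c := near_eq_derive c nu; have Dv c := near_eq_derive c nv.
  have ue t : u (t, p) = u' (t, p) by exact: uu.
  have ve t : v (t, p) = v' (t, p) by exact: vv.
  rewrite !ue !ve !Du !Dv; congr (_ + _).
  by apply: eq_bigr => j _; rewrite !ue !ve !Du !Dv.
rewrite /broken_bracket; case: ifP => _.
  exact: (congr1 (fun F => lim (F y @[y --> x^'])) E).
exact: (congr1 (fun F => F x) E).
Qed.

Lemma bracket_formula_linearl (a : R) u u' v z :
  differentiable u z -> differentiable u' z ->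
  bracket_formula (a *: u + u') v z = a * bracket_formula u v z + bracket_formula u' v z.
Proof.
move=> du du'.
have D c : 'D_c (a *: u + u') z = a * 'D_c u z + 'D_c u' z.
  have d1 : derivable u z c := diff_derivable du.
  have d2 : derivable u' z c := diff_derivable du'.
  have d3 : derivable (a *: u) z c by exact: derivableZ.
  by rewrite (deriveD d3 d2) (deriveZ _ d1).
have ev y : (a *: u + u') y = a * u y + u' y by [].
rewrite /bracket_formula /dx /dp D ev.
under eq_bigr do rewrite D ev.
pose F u j := u (z.2 0 j, z.2) * dp j v z - v (z.2 0 j, z.2) * dp j u z.
rewrite [X in _ + X = _](_ : _ = a * (\sum_(j < n) F u j) + \sum_(j < n) F u' j).
  by rewrite /F /dp; ring.
by rewrite mulr_sumr -big_split; apply: eq_bigr => j _ /=; rewrite /F /dp; ring.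
Qed.

Lemma broken_bracket_linearl (a : R) u u' v : smooth_section u -> smooth_section u' ->
  smooth_section v ->
  eq_over B (broken_bracket (a *: u + u') v) (a *: broken_bracket u v + broken_bracket u' v).
Proof.
move=> su su' sv; apply: smooth_section_eq.
- by apply: smooth_section_bracket => //; exact: smooth_section_linear.
- by apply: smooth_section_linear; exact: smooth_section_bracket.
- move=> z zN; have [_ zN'] := zN.
  rewrite [RHS]/(a * broken_bracket u v z + broken_bracket u' v z) !broken_bracket_off//.
  by apply: bracket_formula_linearl;
    apply: smooth_at_differentiable; exact: smooth_section_off.
Qed.

Lemma broken_bracket_linearr (a : R) u v v' : smooth_section u -> smooth_section v ->
  smooth_section v' ->
  eq_over B (broken_bracket u (a *: v + v')) (a *: broken_bracket u v + broken_bracket u v').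
Proof.
move=> su sv sv' x p pB.
have svv := smooth_section_linear a sv sv'.
rewrite (broken_bracket_antisym su svv)// fctE (broken_bracket_linearl a sv sv' su)//.
rewrite !fctE (broken_bracket_antisym su sv)// (broken_bracket_antisym su sv')// !fctE.
by rewrite scalerN opprD.
Qed.

(** The lift of the bracket of v and w is the commutator of their lifts. *)
Lemma components_bracket v w k z : smooth_section v -> smooth_section w -> off_breaks z ->
  components (broken_bracket v w) (broken_bracket v w) k z =
  LX v (components w w k) z - LX w (components v v k) z.
Proof.
move=> sv sw zN; case: k => [i|]; last first.
  by have [_ /nbhs_singleton] := smooth_at_bracket_off sv sw zN.
have tr u f : smooth_section u -> smooth_section f ->
    LX u (components f f (Some i)) z = 'D_(anchor_field u z.2) (break_value i f) z.2.
  move=> su sf; rewrite lie_derivativeE; last first.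
    apply: smooth_at_differentiable; apply: smooth_at_components => //; first exact: zN.1.
    exact: smooth_section_off.
  exact: (derive_base (break_value i f)).
by rewrite !tr//; exact: (break_value_broken_bracket i sv sw zN.1).
Qed.

Lemma broken_bracket_nested u v w z :
  smooth_section u -> smooth_section v -> smooth_section w -> off_breaks z ->
  broken_bracket u (broken_bracket v w) z =
  (LX u (LX v w) z - LX u (LX w v) z) - (LX v (LX w u) z - LX w (LX v u) z).
Proof.
move=> su sv sw zN; have sb := smooth_section_bracket sv sw.
have so f : smooth_section f -> smooth_at z f by move=> sf; exact: smooth_section_off.
have sc f k : smooth_section f -> smooth_at z (components f f k).
  by move=> sf; apply: smooth_at_components => //; [exact: zN.1|exact: so].
have [_ E] := smooth_at_bracket_off sv sw zN.
have [_ /nbhs_singleton ->] := smooth_at_bracket_off su sb zN.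
rewrite !fctE; congr (_ - _).
  rewrite (lie_derivative_ext _ _ E) lie_derivativeB//;
    by apply: smooth_at_lie_derivative => [k|]; [exact: sc|exact: so].
rewrite lie_derivative_commutator; [|by move=> k; exact: sc|by move=> k; exact: sc|exact: so].
by apply: eq_bigr => k _; rewrite components_bracket.
Qed.

Lemma broken_bracket_jacobi u v w :
  smooth_section u -> smooth_section v -> smooth_section w ->
  eq_over B (broken_bracket u (broken_bracket v w) + broken_bracket v (broken_bracket w u)
             + broken_bracket w (broken_bracket u v)) 0.
Proof.
move=> su sv sw; apply: smooth_section_eq.
- apply: smooth_section_D; first apply: smooth_section_D.
  + by apply: smooth_section_bracket => //; exact: smooth_section_bracket.
  + by apply: smooth_section_bracket => //; exact: smooth_section_bracket.
  + by apply: smooth_section_bracket => //; exact: smooth_section_bracket.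
- exact: smooth_section_zero.
- move=> z zN.
  suff : broken_bracket u (broken_bracket v w) z +
    broken_bracket v (broken_bracket w u) z + broken_bracket w (broken_bracket u v) z = 0.
    exact.
  rewrite (broken_bracket_nested su sv sw zN) (broken_bracket_nested sv sw su zN).
  rewrite (broken_bracket_nested sw su sv zN).
  (* Each of the six triple products occurs twice, with opposite signs. *)
  move: (LX u (LX v w) z) (LX u (LX w v) z) (LX v (LX w u) z) (LX v (LX u w) z)
    (LX w (LX u v) z) (LX w (LX v u) z) => uvw uwv vwu vuw wuv wvu.
  by ring.
Qed.

Lemma broken_bracket_leibniz u v f : smooth_section u -> smooth_section v ->
  smooth_fun B f ->
  eq_over B (broken_bracket u (fun z => f z.2 * v z))
    (fun z => f z.2 * broken_bracket u v z + 'D_(anchor_field u z.2) f z.2 * v z).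
Proof.
move=> su sv sf x p pB; have sfv := smooth_section_M sf sv.
have sb := smooth_section_bracket su sv.
have sb' := smooth_section_bracket su sfv.
apply: (@eq_off_breaks _ _ p (fun x => broken_bracket u (fun z => f z.2 * v z) (x, p))
  (fun x => f p * broken_bracket u v (x, p) + 'D_(anchor_field u p) f p * v (x, p))).
- exact: smooth_section_slice.
- apply: cvgD; apply: cvgM; try exact: cvg_cst.
    exact: (@smooth_section_slice _ p x sb pB).
  exact: (@smooth_section_slice _ p x sv pB).
- move=> y yN; have zN : off_breaks (y, p) by split.
  have so g : smooth_section g -> smooth_at (y, p) g by move=> sg; exact: smooth_section_off.
  have sfs : smooth_at (y, p) (fun z : R * 'rV[R]_n => f z.2).
    by apply: smooth_at_base; exact: smooth_funP.
  have [_ /nbhs_singleton ->] := smooth_at_bracket_off su sfv zN.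
  have [_ /nbhs_singleton ->] := smooth_at_bracket_off su sv zN.
  rewrite !fctE (lie_derivativeM _ _ sfs (so _ sv)).
  rewrite (@lie_derivativeE _ _ u u _ _ (smooth_at_differentiable sfs)) derive_base /=.
  (* The lift of f v is f X_v, because f does not depend on x. *)
  have -> : LX (fun z => f z.2 * v z) u (y, p) = f p * LX v u (y, p).
    rewrite /lie_derivative mulr_sumr; apply: eq_bigr => -[i|] _ /=; last by rewrite mulrA.
    by rewrite /break_value /break_point /= mulrA.
  by ring.
Qed.

End Identities.

Theorem proposition4p4 (R : realType) (n : nat) (hn : (1 <= n)%N) :
  lie_algebroid (@cyc_ordered R n) broken_field smooth_section
    broken_bracket broken_anchor.
Proof.
split.
- by move=> p _; exact: broken_field_zero.
- by move=> p a w1 w2 _; exact: broken_field_linear.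
- by move=> u [].
- exact: smooth_section_zero.
- exact: smooth_section_D.
- exact: smooth_section_M.
- by move=> p a w1 w2 _ _ _; apply/rowP => i; rewrite !mxE.
- move=> u su i.
  have -> : (fun p => broken_anchor p (fun x => u (x, p)) 0 i) = break_value i u.
    by apply/funext => p; exact: anchor_fieldE.
  split; first by move=> p m; exact: break_value_lattice.
  by apply: smooth_at_on => p; exact: smooth_section_break_value.
- exact: smooth_section_bracket.
- by move=> u u' v v' _ _ _ _; exact: broken_bracket_ext.
- exact: broken_bracket_linearl.
- exact: broken_bracket_linearr.
- exact: broken_bracket_antisym.
- exact: broken_bracket_jacobi.
- exact: broken_bracket_leibniz.
Qed.
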